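(* Let $G$ be a Hilbert space and let $L$ be the generator of a uniformly continuous normal CP-semigroup on $\mathscr{B}(G)$, given in minimal Gorini-Kossakowski-Sudarshan-Lindblad form $$L(b)=\sum_{i\in I}L_i^*bL_i+b\beta+\beta^*b ,$$ and let $$K(b)=\sum_{j\in J}K_j^*bK_j+b\alpha+\alpha^*b$$ be another generator of a uniformly continuous normal CP-semigroup on $\mathscr{B}(G)$ in (not necessarily minimal) Gorini-Kossakowski-Sudarshan-Lindblad form, where $L_i,\beta,K_j,\alpha\in\mathscr{B}(G)$ and $I,J$ are index sets of arbitrary cardinality. Then $K=L$ if and only if there exist a vector $\eta'=(\eta'_j)_{j\in J}\in\ell^2(J)$, an isometry $M=(a_{ji})_{j\in J,i\in I}\colon\ell^2(I)\to\ell^2(J)$, and a number $h\in\mathbb{R}$ such that, with $$\eta:=-M^*\eta'\in\ell^2(I),\qquad \gamma:=ih-\tfrac{1}{2}\langle\eta',\eta'\rangle\in\mathbb{C},$$ one has $$\alpha=\beta+\gamma\mathbf{1}+\sum_{i\in I}\overline{\eta_i}\,L_i,\qquad K_j=\eta'_j\mathbf{1}+\sum_{i\in I}a_{ji}L_i\quad(j\in J).$$ Infinite sums are understood as strongly convergent.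
   Context: A CP-map is a completely positive linear map. A uniformly continuous normal CP-semigroup on $\mathscr{B}(G)$ is a norm-continuous one-parameter semigroup of normal CP-maps on $\mathscr{B}(G)$ starting at the identity; its generator is the bounded map $L$ with $T_t=e^{tL}$. In a Gorini-Kossakowski-Sudarshan-Lindblad form, $\sum_i L_i^*L_i$ is required to converge strongly. The form with coefficients $(L_i)_{i\in I},\beta$ is called minimal if $\mathbf{1}$ and the $L_i$ are linearly independent in the $\ell^2$-sense: whenever $z_0\in\mathbb{C}$ and $(z_i)_{i\in I}\in\ell^2(I)$ satisfy $z_0\mathbf{1}+\sum_{i\in I}z_iL_i=0$, then $z_0=0$ and all $z_i=0$. Here $\ell^2(I)$, $\ell^2(J)$ are the Hilbert spaces of dimension $\#I$, $\#J$ (written $\mathbb{C}^{\#I}$, $\mathbb{C}^{\#J}$ in the paper). The inner product is linear in the second variable. *)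

(* Defs.v *)
From HB Require Import structures.
From mathcomp Require Import all_boot all_order all_algebra finmap ring.
From mathcomp Require Import all_classical reals topology normedtype sequences.
From mathcomp Require Export complex.
From mathcomp Require summability.

Set Implicit Arguments.
Unset Strict Implicit.
Unset Printing Implicit Defensive.
Import Order.TTheory GRing.Theory Num.Theory.
Import numFieldNormedType.Exports.
Local Open Scope classical_set_scope.
Local Open Scope ring_scope.

HB.mixin Record isInnerProductSpace (R : realType) V of NormedModule R[i] V := {
  inner : V -> V -> R[i] ;
  inner_linear : forall x, scalar (inner x) ;
  inner_conj : forall x y, inner x y = (inner y x)^* ;
  inner_norm : forall x, inner x x = `|x| ^+ 2
}.

#[short(type="innerProductType")]
HB.structure Definition InnerProductSpace (R : realType) :=
  {V of NormedModule R[i] V & isInnerProductSpace R V}.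

#[short(type="hilbertType")]
HB.structure Definition Hilbert (R : realType) :=
  {V of InnerProductSpace R V & Complete V}.

HB.factory Record Lmodule_isInnerProductSpace (R : realType) V
    of GRing.Lmodule R[i] V := {
  ip : V -> V -> R[i] ;
  ip_linear : forall x, scalar (ip x) ;
  ip_conj : forall x y, ip x y = (ip y x)^* ;
  ip_ge0 : forall x, 0 <= ip x x ;
  ip_eq0 : forall x, ip x x = 0 -> x = 0
}.

HB.builders Context R V of Lmodule_isInnerProductSpace R V.

Let ipDr x y z : ip x (y + z) = ip x y + ip x z.
Proof. by have := ip_linear x 1 y z; rewrite scale1r mul1r. Qed.

Let ip0r x : ip x 0 = 0.
Proof. by apply: (@addrI _ (ip x 0)); rewrite -ipDr !addr0. Qed.

Let ipZr x a y : ip x (a *: y) = a * ip x y.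
Proof. by have := ip_linear x a y 0; rewrite !addr0 ip0r addr0. Qed.

Let ipDl x y z : ip (y + z) x = ip y x + ip z x.
Proof. by rewrite ip_conj ipDr rmorphD/= -!ip_conj. Qed.

Let ipZl x a y : ip (a *: y) x = a^* * ip y x.
Proof. by rewrite ip_conj ipZr rmorphM/= -ip_conj. Qed.

Let nrm x : R[i] := sqrtC (ip x x).

Let nrm_ge0 x : 0 <= nrm x. Proof. by rewrite /nrm sqrtC_ge0 ip_ge0. Qed.

Let nrmK x : nrm x ^+ 2 = ip x x. Proof. exact: sqrtCK. Qed.

Let cauchy_schwarz x y : `|ip x y| <= nrm x * nrm y.
Proof.
have [y0|y0] := eqVneq (ip y y) 0.
  by rewrite (ip_eq0 y0) ip0r normr0 mulr_ge0.
have yy0 : 0 < ip y y by rewrite lt_def y0 ip_ge0.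
rewrite -ler_sqr ?nnegrE ?mulr_ge0// exprMn !nrmK normCK -ip_conj.
have yyR : (ip y y)^* = ip y y by rewrite -ip_conj.
have := ip_ge0 (ip y y *: x + (- ip y x) *: y).
rewrite ipDl !ipDr !ipZl !ipZr !yyR rmorphN/= -(ip_conj x y) => h.
rewrite -subr_ge0 -(pmulr_rge0 _ yy0); apply: le_trans h _.
by rewrite le_eqVlt; apply/orP; left; apply/eqP; ring.
Qed.

Let nrmD x y : nrm (x + y) <= nrm x + nrm y.
Proof.
rewrite -ler_sqr ?nnegrE ?addr_ge0// nrmK ipDl !ipDr.
rewrite (_ : (nrm x + nrm y) ^+ 2 = ip x x + (nrm x * nrm y + (nrm x * nrm y + ip y y))); last first.
  by rewrite -!nrmK; ring.
rewrite -addrA lerD2l addrA [leRHS]addrA lerD2r.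
rewrite (ip_conj y x) -mulr2n -mulr_natl.
rewrite -[X in X <= _](@divfK _ 2) ?pnatr_eq0//.
rewrite mulrC ler_wpM2l// -ReE.
apply: le_trans (cauchy_schwarz x y).
apply: le_trans (leif_normC_Re_Creal _).1; apply: real_ler_norm; exact: Creal_Re.
Qed.

Let nrmZ a x : nrm (a *: x) = `|a| * nrm x.
Proof.
apply/eqP; rewrite -(@eqrXn2 _ 2) ?mulr_ge0// exprMn !nrmK ipZl ipZr normCK.
by apply/eqP; ring.
Qed.

Let nrm_eq0 x : nrm x = 0 -> x = 0.
Proof. by move=> x0; apply: ip_eq0; rewrite -nrmK x0 expr0n. Qed.

HB.instance Definition _ := Lmodule_isNormed.Build R[i] V nrmD nrmZ nrm_eq0.
HB.instance Definition _ := isInnerProductSpace.Build R V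
  ip_linear ip_conj (fun x => esym (nrmK x)).
HB.end.

Section BoundedOperators.
Variables (R : realType) (V W : normedModType R[i]).

Definition bounded_linear : {pred V -> W} := fun f =>
  `[< linear f /\ exists M : R, forall x, `|f x| <= M%:C%C * `|x| >].

Fact bounded_linear_submod : submod_closed bounded_linear.
Proof.
split=> [|a f g /asboolP[lf [M Mf]] /asboolP[lg [N Ng]]]; apply/asboolP; split.
- by move=> c x y; change ((0 : W) = c *: 0 + 0); rewrite scaler0 addr0.
- by exists 0 => x; change (`|0 : W| <= 0%:C%C * `|x|); rewrite normr0 mul0r.
- move=> c x y; change (a *: f (c *: x + y) + g (c *: x + y) = c *: (a *: f x + g x) + (a *: f y + g y)); rewrite lf lg !scalerDr !scalerA (mulrC a c).
  by rewrite -!addrA; congr (_ + _); rewrite addrCA.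
- exists (Normc.normc a * M + N) => x; change (`|a *: f x + g x| <= (Normc.normc a * M + N)%:C%C * `|x|); rewrite (le_trans (ler_normD _ _))//.
  rewrite rmorphD rmorphM/= mulrDl lerD// normrZ -mulrA.
  by apply: ler_wpM2l (Mf x); rewrite ?normr_ge0.
Qed.

HB.instance Definition _ := GRing.isSubmodClosed.Build R[i] (V -> W)
  bounded_linear bounded_linear_submod.

Record bop := Bop { bop_fun :> V -> W ; bop_boundedP : bop_fun \in bounded_linear }.

HB.instance Definition _ := [isSub for bop_fun].
HB.instance Definition _ := [Choice of bop by <:].
HB.instance Definition _ := [SubChoice_isSubLmodule of bop by <:].

Implicit Types A B : bop.

Lemma bopP A B : A =1 B -> A = B.
Proof. by move=> AB; apply/val_inj/funext. Qed.

Fact bop_linear A : linear A.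
Proof. by have /asboolP[] := bop_boundedP A. Qed.
HB.instance Definition _ A := GRing.isLinear.Build R[i] V W _ A (bop_linear A).

Lemma bop_bounded A : exists M : R, forall x, `|A x| <= M%:C%C * `|x|.
Proof. by have /asboolP[] := bop_boundedP A. Qed.

Lemma bopD A B x : (A + B) x = A x + B x. Proof. by []. Qed.
Lemma bopZ a A x : (a *: A) x = a *: A x. Proof. by []. Qed.

(* The norm of V and W takes its values in R[i] (as a real number), so that
   the supremum is taken over the real parts. *)
Definition opnorm A : R := sup [set complex.Re `|A x| | x in [set x | `|x| <= 1]].

Let nrmE (U : normedModType R[i]) (x : U) : `|x| = (complex.Re `|x|)%:C%C.
Proof. by rewrite RRe_real// normr_real. Qed.

Let opnorm_has_sup A :
  has_sup [set complex.Re `|A x| | x in [set x | `|x| <= 1]].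
Proof.
split; first by exists (complex.Re `|A 0|); exists 0; rewrite //= normr0.
have [M MA] := bop_bounded A.
exists `|M| => _ [x /= x1 <-]; rewrite -lecR -nrmE (le_trans (MA x))//.
rewrite (@le_trans _ _ (`|M|%:C%C * `|x|))//.
  by rewrite ler_wpM2r// lecR ler_norm.
by rewrite ler_piMr// ler0c.
Qed.

Lemma opnorm_le A x : `|A x| <= (opnorm A)%:C%C * `|x|.
Proof.
have [->|x0] := eqVneq x 0; first by rewrite linear0 !normr0 mulr0.
have nx0 : 0 < `|x| by rewrite normr_gt0.
rewrite -ler_pdivrMr// mulrC -[X in X * _]gtr0_norm ?invr_gt0// -normrZ.
rewrite -linearZ/= (nrmE (A _)) lecR; apply: sup_upper_bound => //=.
by exists (`|x|^-1 *: x) => //=; rewrite normfZV.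
Qed.

Lemma opnorm_min A (M : R) : 0 <= M ->
  (forall x, `|A x| <= M%:C%C * `|x|) -> opnorm A <= M.
Proof.
move=> M0 MA; apply: ge_sup; first exact: (opnorm_has_sup A).1.
move=> _ [x /= x1 <-]; rewrite -lecR -nrmE (le_trans (MA x))//.
by rewrite ler_piMr// ler0c.
Qed.

Lemma opnorm_ge0 A : 0 <= opnorm A.
Proof.
apply: (@le_trans _ _ (complex.Re `|A 0|)); first by rewrite linear0 normr0.
by apply: sup_upper_bound => //; exists 0; rewrite //= normr0.
Qed.

Let opnormD A B : (opnorm (A + B))%:C%C <= (opnorm A)%:C%C + (opnorm B)%:C%C.
Proof.
rewrite -rmorphD lecR; apply: opnorm_min; first by rewrite addr_ge0 ?opnorm_ge0.
by move=> x; rewrite rmorphD mulrDl (le_trans (ler_normD _ _))// lerD ?opnorm_le.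
Qed.

Let opnormZ_le a A : opnorm (a *: A) <= Normc.normc a * opnorm A.
Proof.
apply: opnorm_min => [|x]; first by apply: mulr_ge0; [rewrite -ler0c; exact: (normr_ge0 a)|exact: opnorm_ge0].
by rewrite rmorphM -mulrA bopZ normrZ; apply: ler_wpM2l (opnorm_le A x); rewrite normr_ge0.
Qed.

Let opnormZ a A : (opnorm (a *: A))%:C%C = `|a| * (opnorm A)%:C%C.
Proof.
apply/eqP; rewrite eq_le; apply/andP; split.
  by have := opnormZ_le a A; rewrite -lecR rmorphM.
have [->|a0] := eqVneq a 0.
  by rewrite normr0 mul0r ler0c opnorm_ge0.
have := opnormZ_le a^-1 (a *: A).
rewrite scalerA mulVf// scale1r -lecR rmorphM/= => h.
by rewrite -ler_pdivlMl ?normr_gt0// -normfV.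
Qed.

Let opnorm_eq0 A : (opnorm A)%:C%C = 0 -> A = 0.
Proof.
move=> A0; apply: bopP => x; have := opnorm_le A x.
by rewrite A0 mul0r normr_le0 => /eqP.
Qed.

HB.instance Definition _ := Lmodule_isNormed.Build R[i] bop
  opnormD opnormZ opnorm_eq0.

Lemma bop_normE A : `|A| = (opnorm A)%:C%C. Proof. by []. Qed.

End BoundedOperators.

Section Composition.
Variables (R : realType) (U V W : normedModType R[i]).

Fact bcomp_subproof (A : bop V W) (B : bop U V) : (A \o B) \in @bounded_linear R U W.
Proof.
apply/asboolP; split; first by move=> a x y /=; rewrite !linearP.
exists (opnorm A * opnorm B) => x /=.
rewrite rmorphM -mulrA (le_trans (opnorm_le A _))//.
by rewrite ler_wpM2l ?ler0c ?opnorm_ge0// opnorm_le.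
Qed.
Definition bcomp A B := Bop (bcomp_subproof A B).

Fact bid_subproof : id \in @bounded_linear R V V.
Proof. by apply/asboolP; split => //; exists 1 => x; rewrite mul1r. Qed.
Definition bid := Bop bid_subproof.

End Composition.

Section Endomorphisms.
Variables (R : realType) (V : normedModType R[i]).

Let bcompA : associative (@bcomp R V V V).
Proof. by move=> A B D; apply: bopP. Qed.
Let bcomp1l : left_id (bid V) (@bcomp R V V V).
Proof. by move=> A; apply: bopP. Qed.
Let bcomp1r : right_id (bid V) (@bcomp R V V V).
Proof. by move=> A; apply: bopP. Qed.
Let bcompDl : left_distributive (@bcomp R V V V) +%R.
Proof. by move=> A B D; apply: bopP. Qed.
Let bcompDr : right_distributive (@bcomp R V V V) +%R.
Proof. by move=> A B D; apply: bopP => x /=; rewrite linearD. Qed.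

HB.instance Definition _ := GRing.Zmodule_isPzRing.Build (bop V V)
  bcompA bcomp1l bcomp1r bcompDl bcompDr.

Lemma bopM (A B : bop V V) x : (A * B) x = A (B x). Proof. by []. Qed.
Lemma bop1 x : (1 : bop V V) x = x. Proof. by []. Qed.

End Endomorphisms.

Notation "''B' ( V )" := (bop V V) (at level 8, format "''B' ( V )") : type_scope.

Notation totally := summability.totally.
Notation partial_sum := summability.partial_sum.
#[global] Existing Instance summability.totally_filter.

Section ComplexComplete.
Variable R : realType.
Local Notation C := R[i]^o.

Let normRe (z : R[i]) : (`|complex.Re z|)%:C%C <= `|z|.
Proof.
rewrite normc_def lecR -sqrtr_sqr ler_wsqrtr//.
by rewrite lerDl sqr_ge0.
Qed.
Let normIm (z : R[i]) : (`|complex.Im z|)%:C%C <= `|z|.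
Proof.
rewrite normc_def lecR -sqrtr_sqr ler_wsqrtr//.
by rewrite lerDr sqr_ge0.
Qed.

Let norm_le (z : R[i]) :
  `|z| <= (`|complex.Re z| + `|complex.Im z|)%:C%C.
Proof.
rewrite [X in `|X|]complexE rmorphD/= (le_trans (ler_normD _ _))//.
have nR (r : R) : `|r%:C%C| = (`|r|)%:C%C.
  by rewrite normc_def/= expr0n addr0 sqrtr_sqr.
rewrite normrM !nR (_ : `|'i%C| = 1) ?mul1r//.
by rewrite normc_def/= expr0n expr1n add0r sqrtr1.
Qed.

Let ltr0Sn2 : 0 < 2 :> R. Proof. exact: ltr0Sn. Qed.

Lemma complex_complete (F : set_system C) : ProperFilter F -> cauchy F -> cvg F.
Proof.
move=> FF /cauchyP Fc.
have cR (f : C -> R) : (forall x y : C, f (x - y) = f x - f y) ->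
    (forall x : C, (`|f x|)%:C%C <= `|x|) -> cvg (f @ F).
  move=> fB fN; apply: cauchy_cvg; apply/cauchyP => e e0.
  have e0' : 0 < e%:C%C by rewrite (ltcR 0 e).
  have [x Fx] := Fc _ e0'.
  exists (f x); rewrite /nbhs/=; apply: filterS Fx => y.
  by rewrite -!ball_normE/= -fB -ltcR; apply: le_lt_trans (fN _).
have /cvg_ex[a Fa] : cvg ((@complex.Re R : C -> R) @ F).
  by apply: cR => //; case=> ? ?; case.
have /cvg_ex[b Fb] : cvg ((@complex.Im R : C -> R) @ F).
  by apply: cR => //; case=> ? ?; case.
apply/cvg_ex; exists (a +i* b : C)%C.
apply/(@cvgrPdist_le _ C) => -[e f]; rewrite ltcE/= => /andP[/eqP-> e0].
near=> z.
rewrite (le_trans (norm_le _))// lecR [e]splitr lerD//.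
  have -> : complex.Re ((a +i* b)%C - z) = a - complex.Re z by case: (z).
  by near: z; exact: (@cvgr_dist_le _ R _ F _ _ _ Fa _ (divr_gt0 e0 ltr0Sn2)).
have -> : complex.Im ((a +i* b)%C - z) = b - complex.Im z by case: (z).
by near: z; exact: (@cvgr_dist_le _ R _ F _ _ _ Fb _ (divr_gt0 e0 ltr0Sn2)).
Unshelve. all: by end_near. Qed.

HB.instance Definition _ := Uniform_isComplete.Build R[i]^o complex_complete.

End ComplexComplete.

Section UnorderedSums.
Variables (R : realType) (I : choiceType).
Local Notation C := R[i]^o.
Implicit Types (f g : I -> C) (A B : {fset I}).

Lemma partial_sumE (V : zmodType) (x : I -> V) A :
  partial_sum x A = \sum_(i <- A) x i.
Proof. by rewrite /partial_sum -(big_seq_fsetE _ _ xpredT x). Qed.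

Lemma partial_sumP (a : R[i]) f g A :
  partial_sum (fun i => a * f i + g i) A = a * partial_sum f A + partial_sum g A.
Proof. by rewrite !partial_sumE big_split/= mulr_sumr. Qed.

Lemma partial_sum_cvgP2 (a : R[i]) f g (lf lg : C) :
  partial_sum f @ totally --> lf -> partial_sum g @ totally --> lg ->
  partial_sum (fun i => a * f i + g i : C) @ totally --> (a * lf + lg : C).
Proof.
move=> cf cg.
have -> : partial_sum (fun i => a * f i + g i : C) =
          ((a \*: partial_sum f) + partial_sum g : {fset I} -> C).
  by apply/funext => A; rewrite partial_sumP.
exact: (@cvgD _ C _ _ _ _ _ _ _ (@cvgZl_tmp _ C _ _ _ a _ _ cf) cg).
Qed.

Lemma partial_sum_lim (T : Type) (F : set_system T) (FF : Filter F)
    (h : I -> T -> C) (l : I -> C) A : (forall i, h i @ F --> l i) ->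
  (fun t => partial_sum (h ^~ t) A) @ F --> partial_sum l A.
Proof.
move=> hl; rewrite partial_sumE.
have -> : (fun t => partial_sum (h ^~ t) A) =
    fun t => \sum_(i <- A) h i t by apply/funext => t; rewrite partial_sumE.
elim: (enum_fset A) => [|i s IHs].
  rewrite big_nil (_ : (fun _ => _) = fun=> 0); first exact: (@cvg_cst C).
  by apply/funext => t; rewrite big_nil.
rewrite big_cons (_ : (fun _ => _) = h i + (fun t => \sum_(j <- s) h j t)).
  exact: (@cvgD _ C _ _ _ _ _ _ _ (hl i) IHs).
by apply/funext => t; rewrite big_cons.
Qed.

Lemma partial_sum_ge0 f A : (forall i, 0 <= f i) -> 0 <= partial_sum f A.
Proof. by move=> f0; apply: sumr_ge0. Qed.

Lemma partial_sum_incl f A B : (forall i, 0 <= f i) -> (A `<=` B)%fset ->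
  partial_sum f A <= partial_sum f B.
Proof.
move=> f0 AB; rewrite !partial_sumE (big_fsetID _ (mem A) B)/=.
rewrite (_ : [fset x in B | x \in A]%fset = A); last first.
  apply/fsetP => x; rewrite !inE/= andbC; case: (boolP (x \in A)) => //= xA.
  exact: (fsubsetP AB).
by rewrite lerDl sumr_ge0.
Qed.

Lemma partial_sum_cvgP f : (forall i, 0 <= f i) ->
  (cvg (partial_sum f @ totally) <-> exists M, forall A, partial_sum f A <= M).
Proof.
move=> f0; split=> [/cvg_ex[l fl]|[M fM]].
  exists (`|l| + 1) => A.
  have /(@cvgrPdist_le _ C)/(_ 1 ltr01) := fl.
  case=> B _ /(_ (A `|` B)%fset (fsubsetUr _ _)) /= h.
  apply: (le_trans (partial_sum_incl f0 (fsubsetUl A B))).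
  rewrite -[leLHS]ger0_norm ?partial_sum_ge0//.
  rewrite -[X in `|X|](subrK l) (le_trans (ler_normD _ _))// addrC lerD2l.
  by rewrite distrC.
have fE A : partial_sum f A = (complex.Re (partial_sum f A))%:C%C.
  by rewrite RRe_real// ger0_real// partial_sum_ge0.
pose D := range (fun A => complex.Re (partial_sum f A)).
have Ds : has_sup D.
  split; first by exists (complex.Re (partial_sum f fset0)); exists fset0.
  exists (complex.Re M) => _ [A _ <-].
  by move: (fM A); rewrite lecE => /andP[].
apply/cvg_ex; exists ((sup D)%:C%C : C).
apply/(@cvgrPdist_le _ C) => -[e e']; rewrite ltcE/= => /andP[/eqP-> e0].
have [_ [A _ <-] sA] := sup_adherent e0 Ds.
exists A => // B /= AB.
rewrite fE -rmorphB/= normc_def/= expr0n addr0 sqrtr_sqr lecR.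
rewrite ger0_norm ?subr_ge0; last by apply: sup_upper_bound => //; exists B.
rewrite lerBlDl -lerBlDr (le_trans (ltW sA))//.
by rewrite -lecR -!fE partial_sum_incl.
Qed.

End UnorderedSums.

Section SquareSummable.
Variables (R : realType) (I : choiceType).
Local Notation C := R[i]^o.

Definition square_summable : {pred I -> R[i]} := fun x =>
  `[< cvg (partial_sum (fun i => `|x i| ^+ 2 : C) @ totally) >].

Lemma square_summableP (x : I -> R[i]) : x \in square_summable <->
  exists M, forall A, partial_sum (fun i => `|x i| ^+ 2 : C) A <= M.
Proof.
have := @partial_sum_cvgP R I (fun i => `|x i| ^+ 2) _.
by move=> <- => [|i]; [split=> /asboolP|exact: exprn_ge0].
Qed.

Fact square_summable_submod : submod_closed square_summable.
Proof.
split=> [|a f g /square_summableP[M Mf] /square_summableP[N Ng]].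
  apply/square_summableP; exists 0 => A; rewrite partial_sumE big1// => i _.
  by rewrite (_ : (0 : I -> R[i]) i = 0)// normr0 expr0n.
apply/square_summableP; exists (2 * (`|a| ^+ 2 * M + N)) => A.
pose h i := `|a| ^+ 2 * `|f i| ^+ 2 + `|g i| ^+ 2 : C.
apply: (@le_trans _ _ (2 * partial_sum h A)); last first.
  by rewrite ler_pM2l ?ltr0n// partial_sumP lerD// ler_wpM2l ?exprn_ge0.
rewrite !partial_sumE mulr_sumr ler_sum// => i _.
rewrite (_ : (a *: f + g) i = a * f i + g i)// /h -exprMn -normrM.
rewrite -subr_ge0 !normCK rmorphD/=.
have k0 : 0 <= `|a * f i - g i| ^+ 2 by apply: exprn_ge0.
rewrite normCK rmorphB/= in k0; apply: (le_trans k0); rewrite le_eqVlt.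
by apply/orP; left; apply/eqP; ring.
Qed.

HB.instance Definition _ := GRing.isSubmodClosed.Build R[i] (I -> R[i])
  square_summable square_summable_submod.

Record l2 := L2 { l2_fun :> I -> R[i] ; l2_summable : l2_fun \in square_summable }.

HB.instance Definition _ := [isSub for l2_fun].
HB.instance Definition _ := [Choice of l2 by <:].
HB.instance Definition _ := [SubChoice_isSubLmodule of l2 by <:].

Implicit Types x y : l2.

Lemma l2_ext x y : x =1 y -> x = y.
Proof. by move=> xy; apply/val_inj/funext. Qed.

Definition l2_inner x y : R[i] := summability.sum (fun i => (x i)^* * y i : C).

Let polar (a b : R[i]) : a^* * b = 4^-1 * `|a + b| ^+ 2 + (- 4^-1 * `|a - b| ^+ 2
   + (- 4^-1 * 'i%C * `|a + 'i%C * b| ^+ 2 + 4^-1 * 'i%C * `|a - 'i%C * b| ^+ 2)).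
Proof.
have ii : 'i%C * 'i%C = -1 :> R[i] by rewrite -expr2 sqr_i.
have ci : ('i%C : R[i])^* = - 'i%C by rewrite /Num.conj/=; apply/eqP; rewrite eq_complex/= oppr0 !eqxx.
rewrite !normCK !rmorphD !rmorphN !rmorphM/= !ci.
set j := 'i%C in ii *; set a' := _^*; set b' := _^*.
transitivity (4^-1 * (2 * (a' * b + a * b') - (2 * (j * j)) * (a' * b - a * b'))).
  by rewrite ii; field.
by ring.
Qed.

Lemma l2_inner_cvg x y :
  partial_sum (fun i => (x i)^* * y i : C) @ totally --> (l2_inner x y : C).
Proof.
suff : cvg (partial_sum (fun i => (x i)^* * y i : C) @ totally) by [].
have cl (z : l2) : cvg (partial_sum (fun i => `|z i| ^+ 2 : C) @ totally).
  by have /asboolP := l2_summable z.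
have cD (f g : I -> C) (a : R[i]) : cvg (partial_sum f @ totally) ->
    cvg (partial_sum g @ totally) ->
    cvg (partial_sum (fun i => a * f i + g i : C) @ totally).
  move=> /cvg_ex[lf cf] /cvg_ex[lg cg]; apply/cvg_ex; exists (a * lf + lg : C).
  exact: (@partial_sum_cvgP2 R I a f g lf lg cf cg).
have c0 : cvg (partial_sum (fun _ : I => 0 : C) @ totally).
  apply/(@partial_sum_cvgP R I (fun=> 0)) => //; exists 0 => A.
  by rewrite partial_sumE big1.
rewrite (_ : (fun i => _) = fun i => (4^-1 * `|(x + y) i| ^+ 2 + (- 4^-1 * `|(x - y) i| ^+ 2
   + (- 4^-1 * 'i%C * `|(x + 'i%C *: y) i| ^+ 2 +
     (4^-1 * 'i%C * `|(x - 'i%C *: y) i| ^+ 2 + 0))))).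
  by do 4! (apply: (cD _ _ _ (cl _))).
by apply/funext => i; rewrite polar addr0.
Qed.

Let cvg_uniq (f : I -> C) (a b : C) :
  partial_sum f @ totally --> a -> partial_sum f @ totally --> b -> a = b.
Proof.
move=> fa fb; exact: (@norm_cvg_unique _ C (partial_sum f @ totally) _ a b fa fb).
Qed.

Fact l2_inner_linear x : scalar (l2_inner x).
Proof.
move=> a y z; have h1 := @l2_inner_cvg x (a *: y + z).
have h2 := @partial_sum_cvgP2 R I a _ _ _ _ (@l2_inner_cvg x y) (@l2_inner_cvg x z).
have E : (fun i => (x i)^* * (a *: y + z) i) =
         (fun i => a * ((x i)^* * y i) + (x i)^* * z i).
  by apply/funext => i; rewrite (_ : (a *: y + z) i = a * y i + z i)//; ring.
rewrite E in h1.
exact: (cvg_uniq h1 h2).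
Qed.

Fact l2_inner_conj x y : l2_inner x y = (l2_inner y x)^*.
Proof.
apply: (@cvg_uniq (fun i => (x i)^* * y i) _ _ (@l2_inner_cvg _ _)).
apply/(@cvgrPdist_le _ C) => e e0.
have /(@cvgrPdist_le _ C)/(_ e e0) := @l2_inner_cvg y x.
apply: filterS => A; congr (_ <= _).
rewrite -[RHS]norm_conjC rmorphB/=; congr `|_ - _|.
  by rewrite conjCK.
rewrite !partial_sumE rmorph_sum/=; apply: eq_bigr => i _.
by rewrite rmorphM/= conjCK mulrC.
Qed.

Let inner_ge x A : partial_sum (fun i => `|x i| ^+ 2 : C) A <= l2_inner x x.
Proof.
have f0 i : 0 <= `|x i| ^+ 2 :> C by apply: exprn_ge0.
have cx := @l2_inner_cvg x x.
have E : (fun i => (x i)^* * x i : C) = (fun i => `|x i| ^+ 2).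
  by apply/funext => i; rewrite normCK mulrC.
rewrite E in cx.
have xR : l2_inner x x \is Num.real by apply/CrealP; rewrite -l2_inner_conj.
have pR : partial_sum (fun i => `|x i| ^+ 2 : C) A \is Num.real.
  by rewrite ger0_real// partial_sum_ge0.
rewrite (real_leNgt pR xR); apply/negP => lt.
have e0 : 0 < (partial_sum (fun i => `|x i| ^+ 2 : C) A - l2_inner x x) / 2.
  by rewrite divr_gt0// subr_gt0.
have /(@cvgrPdist_le _ C)/(_ _ e0)[B _ /(_ (A `|` B)%fset (fsubsetUr _ _))/=] := cx.
have := partial_sum_incl f0 (fsubsetUl A B).
set p := partial_sum _ (_ `|` _)%fset; set q := partial_sum _ A in lt e0 * => qp.
have lp : l2_inner x x <= p by apply: le_trans qp; exact: ltW.
rewrite distrC ger0_norm ?subr_ge0// => h.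
have : (q - l2_inner x x) <= (q - l2_inner x x) / 2.
  by apply: le_trans h; rewrite lerD2r.
by rewrite ler_pdivlMr// mulr_natr mulr2n gerDl subr_le0 => /(lt_le_trans lt); rewrite ltxx.
Qed.

Fact l2_inner_ge0 x : 0 <= l2_inner x x.
Proof. by apply: le_trans (inner_ge x fset0); rewrite partial_sumE big_seq_fset0. Qed.

Fact l2_inner_eq0 x : l2_inner x x = 0 -> x = 0.
Proof.
move=> x0; apply: l2_ext => i; have := inner_ge x [fset i]%fset.
rewrite x0 partial_sumE big_seq_fset1 => h.
by apply/eqP; rewrite -normr_eq0 -sqrf_eq0 eq_le h exprn_ge0.
Qed.

HB.instance Definition _ := Lmodule_isInnerProductSpace.Build R l2
  l2_inner_linear l2_inner_conj l2_inner_ge0 l2_inner_eq0.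

Lemma l2_norm_ge x A : partial_sum (fun i => `|x i| ^+ 2 : C) A <= `|x| ^+ 2.
Proof. by rewrite -inner_norm; exact: inner_ge. Qed.

Lemma l2_coord_le x i : `|x i| <= `|x|.
Proof.
rewrite -ler_sqr ?nnegrE//; apply: le_trans (l2_norm_ge x [fset i]%fset).
by rewrite partial_sumE big_seq_fset1.
Qed.

Lemma l2_norm_le x M : 0 <= M ->
  (forall A, partial_sum (fun i => `|x i| ^+ 2 : C) A <= M ^+ 2) -> `|x| <= M.
Proof.
move=> M0 xM; rewrite -ler_sqr ?nnegrE// -inner_norm.
have xR : l2_inner x x \is Num.real by apply/CrealP; rewrite -l2_inner_conj.
rewrite (real_leNgt xR (ger0_real (exprn_ge0 2 M0))); apply/negP => lt.
have e0 : 0 < (inner x x - M ^+ 2) / 2 by rewrite divr_gt0// subr_gt0.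
have cx := @l2_inner_cvg x x.
have E : (fun i => (x i)^* * x i : C) = (fun i => `|x i| ^+ 2).
  by apply/funext => i; rewrite normCK mulrC.
rewrite E in cx.
have /(@cvgrPdist_le _ C)/(_ _ e0)[B _ /(_ B (fsubset_refl _))/=] := cx.
rewrite -[l2_inner x x]/(inner x x) ger0_norm; last first.
  by rewrite subr_ge0 (le_trans (xM B))// ltW.
move=> h.
have : (inner x x - M ^+ 2) <= (inner x x - M ^+ 2) / 2.
  by apply: le_trans h; rewrite lerD2l lerN2.
by rewrite ler_pdivlMr// mulr_natr mulr2n gerDl subr_le0 => /(lt_le_trans lt); rewrite ltxx.
Qed.

Lemma l2_complete (F : set_system l2) : ProperFilter F -> cauchy F -> cvg F.
Proof.
move=> FF /cauchyP Fc.
have /choice[y Fy] i : exists l : C, (fun x : l2 => x i : C) @ F --> l.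
  apply/cvg_ex; apply: complex_complete; apply/cauchyP => e e0.
  have [x Fx] := Fc _ e0; exists (x i).
  apply: (@filterS _ F _ (ball x e)) Fx => z.
  by rewrite -!ball_normE/=; apply: le_lt_trans (l2_coord_le (x - z) i).
have key (x : l2) (e : R[i]) : 0 < e -> F (ball x e) ->
    forall A, partial_sum (fun i => `|x i - y i| ^+ 2 : C) A <= e ^+ 2.
  move=> e0 Fx A.
  pose g (z : l2) := partial_sum (fun i => `|x i - z i| ^+ 2 : C) A.
  have gF : g @ F --> partial_sum (fun i => `|x i - y i| ^+ 2 : C) A.
    apply: partial_sum_lim => i.
    have h : (fun z : l2 => x i - z i : C) @ F --> (x i - y i : C).
      exact: (@cvgB _ C _ _ _ _ _ _ _ (@cvg_cst _ _ _ _ _) (Fy i)).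
    have fF : Filter F by typeclasses eauto.
    have n := @cvg_norm _ C _ _ fF _ _ h.
    exact: (@cvgM R[i] _ _ fF _ _ _ _ n n).
  have gR (z : I -> R[i]) : partial_sum (fun i => `|x i - z i| ^+ 2 : C) A \is Num.real.
    by rewrite ger0_real// partial_sum_ge0// => i; exact: exprn_ge0.
  rewrite (real_leNgt (gR _) (ger0_real (exprn_ge0 2 (ltW e0)))); apply/negP => lt.
  have d0 : 0 < partial_sum (fun i => `|x i - y i| ^+ 2 : C) A - e ^+ 2.
    by rewrite subr_gt0.
  have /(@cvgrPdist_lt _ C)/(_ _ d0) Fg := gF.
  near F => z.
  have : ball x e z by near: z.
  rewrite -ball_normE/= => /ltW xz.
  have gz : g z <= e ^+ 2.
    apply: le_trans (l2_norm_ge (x - z) A) _.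
    by rewrite ler_sqr ?nnegrE// ltW.
  have : `|partial_sum (fun i => `|x i - y i| ^+ 2 : C) A - g z| < partial_sum (fun i => `|x i - y i| ^+ 2 : C) A - e ^+ 2.
    by near: z.
  rewrite ger0_norm; last by rewrite subr_ge0 (le_trans gz)// ltW.
  by rewrite ltrD2l ltrN2 => /lt_le_trans/(_ gz); rewrite ltxx.
have ys : y \in square_summable.
  have [x Fx] := Fc 1 ltr01.
  have xy : (fun i => x i - y i) \in square_summable.
    by apply/square_summableP; exists (1 ^+ 2); exact: key.
  rewrite (_ : y = (x : I -> R[i]) - (fun i => x i - y i)).
    by rewrite rpredB ?l2_summable.
  by apply/funext => i; rewrite [RHS](_ : _ = x i - (x i - y i))// subKr.
apply/cvg_ex; exists (L2 ys).
apply/cvgrPdist_le => e e0; have e20 : 0 < e / 2 by rewrite divr_gt0.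
have [x Fx] := Fc _ e20.
have xy : `|x - L2 ys| <= e / 2.
  by apply: l2_norm_le; [exact: ltW|exact: key].
apply: filterS Fx => z; rewrite -ball_normE/= => xz.
rewrite -(subrK x (L2 ys)) -addrA (le_trans (ler_normD _ _))// [e in leRHS]splitr.
rewrite lerD//; last exact: ltW.
by rewrite distrC.
Unshelve. all: by end_near. Qed.

HB.instance Definition _ := Uniform_isComplete.Build l2 l2_complete.

End SquareSummable.

Section L2Basis.
Variables (R : realType) (I : choiceType).

Fact l2_delta_subproof (i : I) :
  (fun k => (k == i)%:R) \in @square_summable R I.
Proof.
apply/square_summableP; exists 1 => A; rewrite partial_sumE.
have [iA|iA] := boolP (i \in A).
  rewrite (big_fsetD1 i)//= eqxx normr1 expr1n big_seq big1 ?addr0// => k.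
  by rewrite !inE => /andP[/negPf-> _]; rewrite normr0 expr0n.
rewrite big_seq big1// => k kA; rewrite (_ : k == i = false) ?normr0 ?expr0n//.
by apply/negP => /eqP ki; rewrite -ki kA in iA.
Qed.
Definition l2_delta (i : I) : l2 R I := L2 (l2_delta_subproof i).

End L2Basis.

Section InnerTheory.
Variables (R : realType) (V : innerProductType R).
Implicit Types (x y z : V) (a : R[i]).

Lemma innerDr x y z : inner x (y + z) = inner x y + inner x z.
Proof. by have := inner_linear x 1 y z; rewrite scale1r mul1r. Qed.

Lemma inner0r x : inner x 0 = 0.
Proof. by apply: (@addrI _ (inner x 0)); rewrite -innerDr !addr0. Qed.

Lemma innerZr x a y : inner x (a *: y) = a * inner x y.
Proof. by have := inner_linear x a y 0; rewrite !addr0 inner0r addr0. Qed.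

Lemma innerNr x y : inner x (- y) = - inner x y.
Proof. by rewrite -scaleN1r innerZr mulN1r. Qed.

Lemma innerDl x y z : inner (y + z) x = inner y x + inner z x.
Proof. by rewrite inner_conj innerDr rmorphD/= -!inner_conj. Qed.

Lemma innerZl x a y : inner (a *: y) x = a^* * inner y x.
Proof. by rewrite inner_conj innerZr rmorphM/= -inner_conj. Qed.

Lemma innerNl x y : inner (- y) x = - inner y x.
Proof. by rewrite -scaleN1r innerZl rmorphN rmorph1 mulN1r. Qed.

Lemma inner_eq0 x : inner x x = 0 -> x = 0.
Proof. by rewrite inner_norm => /eqP; rewrite sqrf_eq0 normr_eq0 => /eqP. Qed.

Lemma inner_separates x y : (forall z, inner x z = inner y z) -> x = y.
Proof.
move=> xy; apply/eqP; rewrite -subr_eq0; apply/eqP/inner_eq0.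
by rewrite innerDl innerNl xy subrr.
Qed.

Lemma norm_addZ x y a : `|x + a *: y| ^+ 2 =
  `|x| ^+ 2 + (a * inner x y + a^* * inner y x + `|a| ^+ 2 * `|y| ^+ 2).
Proof.
rewrite -!inner_norm innerDl !innerDr !innerZr !innerZl normCK.
by ring.
Qed.

Lemma inner_normCK x y : inner x y * inner y x = `|inner x y| ^+ 2.
Proof. by rewrite normCK -inner_conj. Qed.

Lemma cauchy_schwarz x y : `|inner x y| <= `|x| * `|y|.
Proof.
have [->|y0] := eqVneq y 0; first by rewrite inner0r !normr0 mulr0.
have yy0 : 0 < `|y| ^+ 2 by rewrite exprn_gt0// normr_gt0.
rewrite -ler_sqr ?nnegrE ?mulr_ge0// exprMn -subr_ge0.
have := exprn_ge0 2 (normr_ge0 (x + (- (inner y x / `|y| ^+ 2)) *: y)).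
rewrite norm_addZ -(pmulr_rge0 _ yy0) => h; apply: (le_trans h).
rewrite le_eqVlt; apply/orP; left; apply/eqP.
rewrite normrN normf_div rmorphN rmorphM/= fmorphV/= -inner_conj.
rewrite (_ : (`|y| ^+ 2)^* = `|y| ^+ 2); last by rewrite -inner_norm -inner_conj.
rewrite expr_div_n (@ger0_norm _ (`|y| ^+ 2)) ?(ltW yy0)//.
rewrite (inner_conj y x) norm_conjC -inner_conj -inner_normCK.
by field; rewrite normr_eq0.
Qed.

Lemma parallelogram x y :
  `|x - y| ^+ 2 = 2 * `|x| ^+ 2 + 2 * `|y| ^+ 2 - 4 * `|2^-1 *: (x + y)| ^+ 2.
Proof.
rewrite -!inner_norm !(innerDl, innerDr, innerNl, innerNr, innerZr, innerZl).
by rewrite fmorphV/= rmorph_nat; field.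
Qed.

End InnerTheory.

Lemma bop_continuous (R : realType) (V W : normedModType R[i]) (A : bop V W) :
  continuous A.
Proof.
move=> x; apply/cvgrPdist_le => e e0.
have M0 : 0 < (opnorm A + 1)%:C%C by rewrite (ltcR 0) ltr_wpDl// opnorm_ge0.
near=> z; rewrite -linearB (le_trans (opnorm_le A _))//.
rewrite (@le_trans _ _ ((opnorm A + 1)%:C%C * `|x - z|))//.
  by rewrite ler_wpM2r// lecR lerDl.
rewrite -ler_pdivlMl//; near: z.
by apply: (@cvgr_dist_le _ V _ _ _ idfun x cvg_id); rewrite mulr_gt0// invr_gt0.
Unshelve. all: by end_near. Qed.

Section Riesz.
Variables (R : realType) (H : hilbertType R) (f : H -> R[i]).
Hypotheses (flin : scalar f) (M : R) (fM : forall x, `|f x| <= M%:C%C * `|x|).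

Let fZ a x : f (a *: x) = a * f x.
Proof.
have f0 : f 0 = 0.
  by apply: (@addrI _ (f 0)); have := flin 1 0 0; rewrite scale1r mul1r !addr0 => <-.
by have := flin a x 0; rewrite f0 !addr0.
Qed.
Let fD x y : f (x + y) = f x + f y.
Proof. by have := flin 1 x y; rewrite scale1r mul1r. Qed.
Let fB x y : f (x - y) = f x - f y.
Proof. by rewrite fD -scaleN1r fZ mulN1r. Qed.

Let nrmR (x : H) : `|x| ^+ 2 = (complex.Re (`|x| ^+ 2))%:C%C.
Proof. by rewrite RRe_real// ger0_real// exprn_ge0. Qed.

Lemma min_norm_exists : (exists x, f x = 1) ->
  exists2 y, f y = 1 & forall x, f x = 1 -> `|y| <= `|x|.
Proof.
move=> [x1 fx1].
pose N (x : H) := complex.Re (`|x| ^+ 2).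
pose D := [set N x | x in [set x | f x = 1]].
have NE x : `|x| ^+ 2 = (N x)%:C%C by exact: nrmR.
have hD : has_inf D.
  split; first by exists (N x1); exists x1.
  by exists 0 => _ [x _ <-]; rewrite -ler0c -NE exprn_ge0.
pose d := inf D.
have dN x : f x = 1 -> d <= N x.
  by move=> fx; apply: ge_inf; [exact: hD.2|exists x].
pose S (e : R) := [set x | f x = 1 /\ N x < d + e].
have S0 e : 0 < e -> S e !=set0.
  move=> e0; have [_ [x fx <-] xe] := inf_adherent e0 hD.
  by exists x; split.
pose F := filter_from [set e : R | 0 < e] S.
have FF : ProperFilter F.
  apply: filter_from_proper; last exact: S0.
  apply: filter_from_filter; first by exists 1; rewrite /= ltr01.
  move=> a b a0 b0; exists (Num.min a b); first by rewrite /= lt_min a0.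
  by move=> x [fx]; rewrite -ltrBlDl lt_min !ltrBlDl => /andP[].
have par x y e : S e x -> S e y -> N (x - y) <= 4 * e.
  move=> [fx xe] [fy ye].
  have fm : f (2^-1 *: (x + y)) = 1 by rewrite fZ fD fx fy; field.
  have : N (x - y) = 2 * N x + 2 * N y - 4 * N (2^-1 *: (x + y)).
    by apply: complexI; rewrite -NE parallelogram !NE -!(rmorph_nat (real_complex R)) -!rmorphM -rmorphD -rmorphB.
  move=> ->; have := dN _ fm => h.
  rewrite (@le_trans _ _ (2 * (d + e) + 2 * (d + e) - 4 * d))//.
    by apply: lerB; [apply: lerD|]; rewrite ler_pM2l// ltW.
  by rewrite le_eqVlt; apply/orP; left; apply/eqP; ring.
have /cvg_ex[y Fy] : cvg F.
  apply: cauchy_cvg; apply/cauchyP => -[e e'].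
  rewrite ltcE/= => /andP[/eqP-> e0]; rewrite complexr0.
  have e20 : 0 < e ^+ 2 / 8 by rewrite divr_gt0// exprn_gt0.
  have [x Sx] := S0 _ e20; exists x; exists (e ^+ 2 / 8) => // z Sz.
  rewrite -ball_normE/=.
  rewrite -ltr_sqr ?nnegrE//; last by rewrite (lecR 0) ltW.
  rewrite NE -rmorphXn/= ltcR (le_lt_trans (par _ _ _ Sx Sz))//.
  rewrite mulrCA gtr_pMr ?exprn_gt0//.
  by rewrite ltr_pdivrMr// mul1r ltr_nat.
have near_y (e : R) : 0 < e -> exists2 z, S e z & `|y - z| <= e%:C%C.
  move=> e0; have e0' : 0 < e%:C%C :> R[i] by rewrite (ltcR 0).
  have [a a0 aS] := Fy _ (nbhsx_ballx y _ e0').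
  have m0 : 0 < Num.min a e by rewrite lt_min a0.
  have [z [fz]] := S0 _ m0.
  rewrite -ltrBlDl lt_min !ltrBlDl => /andP[za ze].
  exists z; first by [].
  by have := aS z (conj fz za); rewrite -ball_normE => /ltW.
have fy : f y = 1.
  apply/eqP; rewrite -subr_eq0 -normr_eq0 eq_le normr_ge0 andbT.
  have nE : `|f y - 1| = (complex.Re `|f y - 1|)%:C%C by rewrite RRe_real// normr_real.
  rewrite nE (lecR _ 0); apply/ler_addgt0Pl => e e0; rewrite addr0.
  have M0 : 0 < `|M| + 1 by rewrite ltr_wpDl.
  have [z [fz _]] := near_y (e / (`|M| + 1)) (divr_gt0 e0 M0).
  move=> yz; rewrite -lecR -nE -fz -fB (le_trans (fM _))//.
  apply: (@le_trans _ _ ((`|M| + 1)%:C%C * `|y - z|)).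
    by rewrite ler_wpM2r// lecR (le_trans (ler_norm _))// lerDl.
  apply: (@le_trans _ _ ((`|M| + 1)%:C%C * (e / (`|M| + 1))%:C%C)).
    by rewrite ler_wpM2l// (lecR 0) ltW.
  by rewrite -rmorphM lecR mulrC divfK ?gt_eqF.
exists y => // x fx.
have nE (z : H) : `|z| = (complex.Re `|z|)%:C%C by rewrite RRe_real// normr_real.
rewrite nE (nE x) lecR; apply/ler_addgt0Pl => e e0.
have x0 : 0 < complex.Re `|x|.
  rewrite -ltcR -nE normr_gt0; apply/eqP => x0; move: fx.
  rewrite x0 -(scale0r 0) fZ mul0r => /eqP; by rewrite eq_sym oner_eq0.
have [m m0 [m1 m2]] : exists2 m : R, 0 < m & m <= e / 2 /\ m <= complex.Re `|x| * e.
  exists (Num.min (e / 2) (complex.Re `|x| * e)); first by rewrite lt_min divr_gt0//= mulr_gt0.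
  by split; rewrite ge_min lexx ?orbT.
have [z [fz zd] yz] := near_y m m0.
have zx : complex.Re `|z| <= complex.Re `|x| + e / 2.
  rewrite -ler_sqr ?nnegrE; last 2 first.
  - by rewrite -(lecR 0) -nE normr_ge0.
  - by rewrite addr_ge0 ?(ltW x0)// divr_ge0// ltW.
  have -> : complex.Re `|z| ^+ 2 = N z.
    by apply: complexI; rewrite rmorphXn/= -nE -NE.
  apply: (@le_trans _ _ (N x + m)).
    by apply: (le_trans (ltW zd)); rewrite lerD2r dN.
  have -> : N x = complex.Re `|x| ^+ 2.
    by apply: complexI; rewrite rmorphXn/= -nE -NE.
  rewrite sqrrD -addrA lerD2l -[leLHS]addr0 lerD ?sqr_ge0//.
  by rewrite -mulr_natr -mulrA divfK// pnatr_eq0.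
rewrite -lecR -nE -(subrK z y) (le_trans (ler_normD _ _))//.
rewrite (nE z) (le_trans (lerD yz (lexx _)))// -rmorphD lecR.
rewrite (le_trans (lerD m1 zx))// addrCA -splitr addrC.
by [].
Qed.

Lemma riesz : exists y, forall x, f x = inner y x.
Proof.
have [f0|/existsNP[x0 fx0]] := pselect (forall x, f x = 0).
  by exists 0 => x; rewrite f0 inner_conj inner0r rmorph0.
have [|y fy ymin] := min_norm_exists.
  exists ((f x0)^-1 *: x0); rewrite fZ mulVf//; exact/eqP.
have orth v : f v = 0 -> inner y v = 0.
  move=> fv; have [->|v0] := eqVneq v 0; first by rewrite inner0r.
  have vv0 : 0 < `|v| ^+ 2 by rewrite exprn_gt0// normr_gt0.
  have : f (y + (- (inner v y / `|v| ^+ 2)) *: v) = 1 by rewrite fD fZ fv mulr0 addr0.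
  move=> /ymin; rewrite -ler_sqr ?nnegrE// norm_addZ lerDl.
  rewrite -(pmulr_rge0 _ vv0).
  rewrite normrN normf_div rmorphN rmorphM/= fmorphV/= -inner_conj.
  rewrite (_ : (`|v| ^+ 2)^* = `|v| ^+ 2); last by rewrite -inner_norm -inner_conj.
  rewrite expr_div_n (@ger0_norm _ (`|v| ^+ 2)) ?(ltW vv0)//.
  rewrite (inner_conj v y) norm_conjC -inner_conj -inner_normCK.
  rewrite (_ : _ * _ = - (inner y v * inner v y)); last first.
    by field; rewrite normr_eq0.
  rewrite oppr_ge0 inner_normCK => h; apply/eqP.
  by rewrite -normr_eq0 -sqrf_eq0 eq_le h exprn_ge0.
have y0 : `|y| ^+ 2 != 0.
  rewrite sqrf_eq0 normr_eq0; apply/eqP => y0; move: fy.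
  by rewrite y0 -(scale0r 0) fZ mul0r => /eqP; rewrite eq_sym oner_eq0.
exists ((`|y| ^+ 2)^-1 *: y) => x.
have := orth (x - f x *: y).
rewrite fB fZ fy mulr1 subrr => /(_ erefl).
rewrite innerDr innerNr innerZr inner_norm => /eqP; rewrite subr_eq0 => /eqP h.
rewrite innerZl h fmorphV/= (_ : (`|y| ^+ 2)^* = `|y| ^+ 2); last first.
  by rewrite -inner_norm -inner_conj.
by rewrite mulrC mulfK.
Qed.

End Riesz.

Section Adjoint.
Variables (R : realType) (G H : hilbertType R).

Definition adjoint (A : bop G H) : bop H G :=
  xget 0 [set B : bop H G | forall x y, inner (B x) y = inner x (A y)].

Lemma adjointE (A : bop G H) x y : inner (adjoint A x) y = inner x (A y).
Proof.
suff [B AB] : [set B : bop H G | forall x y, inner (B x) y = inner x (A y)] !=set0.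
  by have := @xgetI _ 0 _ _ AB => /(_ x y).
have /choice[g gA] z : exists w : G, forall y, inner z (A y) = inner w y.
  apply: (@riesz R G (fun y => inner z (A y)) _ (complex.Re `|z| * opnorm A)).
    by move=> a u v; rewrite linearP innerDr innerZr.
  move=> u; rewrite rmorphM/= RRe_real ?normr_real// -mulrA.
  by rewrite (le_trans (cauchy_schwarz _ _))// ler_wpM2l// opnorm_le.
have gb : g \in @bounded_linear R H G.
  apply/asboolP; split=> [a u v|].
    apply: inner_separates => w.
    by rewrite innerDl innerZl -!gA innerDl innerZl.
  exists (opnorm A) => u.
  have [->|gu0] := eqVneq (g u) 0; first by rewrite normr0 mulr_ge0// ler0c opnorm_ge0.
  have gu : 0 < `|g u| by rewrite normr_gt0.
  rewrite -(ler_pM2r gu) -expr2 -inner_norm -gA.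
  rewrite -[inner _ _]ger0_norm; last by rewrite gA inner_norm exprn_ge0.
  rewrite (le_trans (cauchy_schwarz _ _))// mulrC -mulrA (mulrC `|u|) mulrA.
  by rewrite ler_wpM2r// opnorm_le.
by exists (Bop gb) => u v; rewrite -gA.
Qed.

End Adjoint.

Section CPSemigroups.
Variables (R : realType) (G : hilbertType R).
Implicit Types (A B : 'B(G)) (D : set 'B(G)) (T L : 'B('B(G))).

Definition positive_bop A := forall x, 0 <= inner x (A x).

Definition bop_le A B := positive_bop (B - A).

(* Positivity of a matrix of operators on G, seen as an operator on the direct
   sum of n copies of G. *)
Definition positive_bop_mx n (b : 'M['B(G)]_n) :=
  forall x : 'I_n -> G, 0 <= \sum_i \sum_j inner (x i) (b i j (x j)).

Definition completely_positive T :=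
  forall n (b : 'M['B(G)]_n), positive_bop_mx b -> positive_bop_mx (map_mx T b).

Definition bop_directed D :=
  D !=set0 /\
  forall A B, D A -> D B -> exists2 A', D A' & bop_le A A' /\ bop_le B A'.

Definition bop_lub D (S : 'B(G)) :=
  (forall A, D A -> bop_le A S) /\
  (forall B, (forall A, D A -> bop_le A B) -> bop_le S B).

(* A positive map is normal if it preserves the suprema of bounded increasing
   nets of self-adjoint operators. *)
Definition normal_map T := forall D S,
  bop_directed D -> (forall A, D A -> adjoint A = A) ->
  bop_lub D S -> bop_lub (T @` D) (T S).

(* Only the values of T on nonnegative reals are constrained; the continuity is
   that for the norm of 'B('B(G)). *)
Definition uniform_normal_CP_semigroup (T : R -> 'B('B(G))) :=
  [/\ T 0 = 1,
      (forall s t, 0 <= s -> 0 <= t -> T (s + t) = T s * T t),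
      (forall t, 0 <= t -> completely_positive (T t) /\ normal_map (T t)) &
      {within [set t | 0 <= t], continuous T}].

Definition exp_coeff_bop (t : R) L n : 'B('B(G)) :=
  (t ^+ n / n`!%:R)%:C%C *: L ^+ n.

Definition generates_CP_semigroup L := exists2 T : R -> 'B('B(G)),
  uniform_normal_CP_semigroup T &
  forall t, 0 <= t -> series (exp_coeff_bop t L) @ \oo --> T t.

End CPSemigroups.

Section GKSL.
Variables (R : realType) (G : hilbertType R) (I : choiceType).
Implicit Types (Li : I -> 'B(G)) (beta : 'B(G)) (L : 'B('B(G))).

(* The net of the sums over finite subsets of I converges strongly to S. *)
Definition strong_sum (A : I -> 'B(G)) (S : 'B(G)) :=
  forall x, partial_sum (fun i => A i x) @ totally --> S x.

Definition GKSL_form Li beta L :=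
  (exists S, strong_sum (fun i => adjoint (Li i) * Li i) S) /\
  (forall b, exists2 S, strong_sum (fun i => adjoint (Li i) * b * Li i) S &
    L b = S + b * beta + adjoint beta * b).

Definition GKSL_minimal Li :=
  forall (z0 : R[i]) (z : l2 R I) (S : 'B(G)),
    strong_sum (fun i => z i *: Li i) S -> z0 *: (1 : 'B(G)) + S = 0 ->
    z0 = 0 /\ forall i, z i = 0.

End GKSL.

Definition l2_entry (R : realType) (I J : choiceType) (M : bop (l2 R I) (l2 R J))
  (j : J) (i : I) : R[i] := M (l2_delta R i) j.

(* Main.v *)
Require Import Defs.
From HB Require Import structures.
From mathcomp Require Import all_boot all_order all_algebra finmap ring lra.
From mathcomp Require Import all_classical reals topology normedtype sequences.

(** Uniqueness of GKSL forms, by reduction to scalar square-summable sequences.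

    For a family (L_i) with strongly convergent sum of adjoint L_i times L_i,
    every pair of vectors v, x of G has a coefficient vector l v x in l2(I), with
    entries <v, L_i x>; let k v x in l2(J) be the same for the K_j.  On the
    rank-one operator |u><v| a generator in GKSL form has the matrix elements
[[
      <y, L(|u><v|) x> = <l u y, l v x> + <y, u> <v, beta x> + <beta y, u> <v, x>
]]
    (GKSL_rank1), so that on such operators everything is a statement about Gram
    matrices of coefficient vectors.  Rank-one operators suffice: two maps in
    GKSL form that agree on them are equal (GKSL_eq_rank1), because the tails of
    the defining sums can be neglected and b may be replaced by b P with P a
    finite-rank projection.

    The equations K_j = eta'_j 1 + sum_i a_ji L_i say exactly that
    k v x = <v, x> eta' + M (l v x) for all v and x (coeff_vec_row).

    If K = L, fix a unit vector e.  The vectors k v x - <v, x> k e e and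
    l v x - <v, x> l e e have the same Gram matrix, since the terms with alpha and
    beta cancel.  Minimality says that the second family is total in l2(I)
    (GKSL_minimal_total), so an isometry M carries it to the first one
    (isometry_extension), and eta' := k e e - M (l e e) (GKSL_eq_isometry).
    Comparing the remaining terms, D := alpha - beta - sum_i conj(eta_i) L_i
    + |eta'|^2 / 2 satisfies b D + D^* b = 0 for all rank-one b, whence D is an
    imaginary scalar (skew_derivation_scalar).

    Conversely, given eta', M and h, the isometry property gives the Gram matrix of
    the k v x (coeff_vec_gram), and the extra terms are compensated by those of
    alpha on rank-one operators, hence everywhere. *)

Set Implicit Arguments.
Unset Strict Implicit.
Unset Printing Implicit Defensive.
Import Order.TTheory GRing.Theory Num.Theory.
Import numFieldNormedType.Exports.
Local Open Scope classical_set_scope.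
Local Open Scope ring_scope.

(** * Norms and inner products *)

Section RealNorms.
Variables (R : realType) (V : normedModType R[i]).
Implicit Types x : V.

Lemma norm_realE x : `|x| = (complex.Re `|x|)%:C%C.
Proof. by rewrite RRe_real// normr_real. Qed.

Lemma norm_eq0_of_le x : (forall e : R, 0 < e -> `|x| <= e%:C%C) -> x = 0.
Proof.
move=> xe; apply/eqP; rewrite -normr_eq0 eq_le normr_ge0 andbT norm_realE.
rewrite (lecR _ 0); apply/ler_addgt0Pl => e e0; rewrite addr0.
by rewrite -lecR -norm_realE xe.
Qed.

End RealNorms.

Section HilbertNorms.
Variables (R : realType) (V : innerProductType R).
Implicit Types x y : V.

Lemma norm_sqr_realE x : `|x| ^+ 2 = (complex.Re (`|x| ^+ 2))%:C%C.
Proof. by rewrite RRe_real// ger0_real// exprn_ge0. Qed.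

Lemma inner0l x : inner 0 x = 0.
Proof. by rewrite -(scale0r (0 : V)) innerZl rmorph0 mul0r. Qed.

Lemma innerBl x y z : inner (y - z) x = inner y x - inner z x.
Proof. by rewrite innerDl innerNl. Qed.

Lemma innerBr x y z : inner x (y - z) = inner x y - inner x z.
Proof. by rewrite innerDr innerNr. Qed.

Lemma inner_suml (I : Type) (s : seq I) (F : I -> V) x :
  inner (\sum_(i <- s) F i) x = \sum_(i <- s) inner (F i) x.
Proof.
by elim/big_rec2: _ => [|i a b _ <-]; rewrite ?inner0l// innerDl.
Qed.

Lemma inner_sumr (I : Type) (s : seq I) (F : I -> V) x :
  inner x (\sum_(i <- s) F i) = \sum_(i <- s) inner x (F i).
Proof.
by elim/big_rec2: _ => [|i a b _ <-]; rewrite ?inner0r// innerDr.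
Qed.

Lemma inner_separatesr x y : (forall z, inner z x = inner z y) -> x = y.
Proof.
by move=> xy; apply: inner_separates => z; rewrite inner_conj xy -inner_conj.
Qed.

End HilbertNorms.

(** * Density of total subspaces *)

Section Density.
Variables (R : realType) (H : hilbertType R) (C : set H).
Hypotheses (C0 : C 0)
  (Clin : forall a c c', C c -> C c' -> C (a *: c + c'))
  (Ctot : forall y, (forall c, C c -> inner c y = 0) -> y = 0).

(** Vectors c of C that nearly minimize the distance to x form a Cauchy filter
    by the parallelogram law; let y be its limit.  Near-minimality also forces
    x - c to be nearly orthogonal to C (otherwise a small step along C would
    come strictly closer), so x - y is orthogonal to C, hence zero by totality.
    The orthogonality is estimated before passing to the limit, so that no
    closure of C has to be formed. *)
Lemma total_dense (x : H) (e : R) : 0 < e -> exists2 c, C c & `|x - c| <= e%:C%C.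
Proof.
pose N (c : H) := complex.Re (`|x - c| ^+ 2).
have NE c : `|x - c| ^+ 2 = (N c)%:C%C by exact: norm_sqr_realE.
pose D := N @` C.
have hD : has_inf D.
  split; first by exists (N 0); exists 0.
  by exists 0 => _ [c _ <-]; rewrite -ler0c -NE exprn_ge0.
pose d := inf D.
have dN c : C c -> d <= N c.
  by move=> Cc; apply: ge_inf; [exact: hD.2|exists c].
pose S (e : R) := [set c | C c /\ N c < d + e].
have S0 a : 0 < a -> S a !=set0.
  move=> a0; have [_ [c Cc <-] ca] := inf_adherent a0 hD.
  by exists c; split.
pose F := filter_from [set a : R | 0 < a] S.
have FF : ProperFilter F.
  apply: filter_from_proper; last exact: S0.
  apply: filter_from_filter; first by exists 1; rewrite /= ltr01.
  move=> a b a0 b0; exists (Num.min a b); first by rewrite /= lt_min a0.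
  by move=> c [Cc]; rewrite -ltrBlDl lt_min !ltrBlDl => /andP[].
have Cmid c c' : C c -> C c' -> C (2^-1 *: (c + c')).
  move=> Cc Cc'; rewrite -[2^-1 *: _]addr0; apply: Clin => //.
  by rewrite -[c]scale1r; exact: Clin.
have par c c' a : S a c -> S a c' -> `|c - c'| ^+ 2 <= (4 * a)%:C%C.
  move=> [Cc ca] [Cc' ca'].
  have -> : `|c - c'| ^+ 2 = (2 * N c + 2 * N c' - 4 * N (2^-1 *: (c + c')))%:C%C.
    have -> : c - c' = (x - c') - (x - c) by rewrite opprB [RHS]addrC addrA subrK.
    rewrite parallelogram.
    have -> : x - c' + (x - c) = 2 *: (x - (2^-1 *: (c + c'))).
      rewrite scalerBr scalerA divff ?scale1r ?pnatr_eq0// addrACA -opprD [c + c']addrC.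
      by rewrite scaler_nat mulr2n.
    rewrite scalerA mulVf ?pnatr_eq0// scale1r !NE.
    by rewrite rmorphB rmorphD !rmorphM !rmorph_nat/= addrC; ring.
  rewrite lecR; have := dN _ (Cmid _ _ Cc Cc') => h.
  rewrite (@le_trans _ _ (2 * (d + a) + 2 * (d + a) - 4 * d))//.
    by apply: lerB; [apply: lerD|]; rewrite ler_pM2l// ltW.
  by rewrite le_eqVlt; apply/orP; left; apply/eqP; ring.
have orth c z a : C c -> S a z -> `|inner c (x - z)| ^+ 2 <= a%:C%C * `|c| ^+ 2.
  move=> Cc [Cz za].
  have [->|c0] := eqVneq c 0; first by rewrite inner0l !normr0 expr0n mulr0.
  have cc0 : 0 < `|c| ^+ 2 by rewrite exprn_gt0// normr_gt0.
  pose t := inner c (x - z) / `|c| ^+ 2.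
  have := dN (t *: c + z) (Clin t Cc Cz); rewrite -lecR -NE.
  have -> : x - (t *: c + z) = (x - z) + (- t) *: c.
    by rewrite scaleNr opprD addrA addrAC.
  rewrite norm_addZ NE => h.
  rewrite -ler_pdivrMr//.
  have e1 : - t * inner (x - z) c + (- t)^* * inner c (x - z) + `|- t| ^+ 2 * `|c| ^+ 2
      = - (`|inner c (x - z)| ^+ 2 / `|c| ^+ 2).
    rewrite normrN /t normf_div rmorphN rmorphM/= fmorphV/= -inner_conj.
    rewrite (_ : (`|c| ^+ 2)^* = `|c| ^+ 2); last by rewrite -inner_norm -inner_conj.
    rewrite expr_div_n (@ger0_norm _ (`|c| ^+ 2)) ?(ltW cc0)//.
    rewrite -inner_normCK; field; by rewrite normr_eq0.
  rewrite e1 in h.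
  have /ltW := za; rewrite -lecR rmorphD => za'.
  have := le_trans h (lerD za' (lexx _)).
  by rewrite -addrA lerDl subr_ge0.
have /cvg_ex[y Fy] : cvg F.
  apply: cauchy_cvg; apply/cauchyP => -[a a'].
  rewrite ltcE/= => /andP[/eqP-> a0]; rewrite complexr0.
  have a20 : 0 < a ^+ 2 / 8 by rewrite divr_gt0// exprn_gt0.
  have [z Sz] := S0 _ a20; exists z; exists (a ^+ 2 / 8) => // c Sc.
  rewrite -ball_normE/=.
  rewrite -ltr_sqr ?nnegrE//; last by rewrite (lecR 0) ltW.
  rewrite (le_lt_trans (par _ _ _ Sz Sc))// -rmorphXn/= ltcR.
  rewrite mulrCA gtr_pMr ?exprn_gt0//.
  by rewrite ltr_pdivrMr// mul1r ltr_nat.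
have near_y (a : R) : 0 < a -> exists2 z, S a z & `|y - z| <= a%:C%C.
  move=> a0; have a0' : 0 < a%:C%C :> R[i] by rewrite (ltcR 0).
  have [b b0 bS] := Fy _ (nbhsx_ballx y _ a0').
  have m0 : 0 < Num.min b a by rewrite lt_min b0.
  have [z [Cz]] := S0 _ m0.
  rewrite -ltrBlDl lt_min !ltrBlDl => /andP[zb za].
  exists z; first by [].
  by have := bS z (conj Cz zb); rewrite -ball_normE => /ltW.
suff xy : x - y = 0.
  move=> e0; have [z [Cz _] yz] := near_y _ e0.
  by exists z => //; rewrite (_ : x = y)//; apply/eqP; rewrite -subr_eq0 xy.
apply: Ctot => c Cc; apply: (@norm_eq0_of_le R R[i]^o) => a a0.
have cE := norm_realE c; set r := complex.Re _ in cE.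
have r0 : 0 <= r by rewrite -(lecR 0) -cE normr_ge0.
have r10 : 0 < r + 1 by rewrite ltr_wpDl.
(* For z in S b with |y - z| <= b, the inner product <c, x - y> is at most
   (sqrt b + b) |c|; this b makes both terms at most a / 2. *)
pose b := Num.min (a / (2 * (r + 1))) ((a / (2 * (r + 1))) ^+ 2).
have ar0 : 0 < a / (2 * (r + 1)) by rewrite divr_gt0// mulr_gt0.
have b0 : 0 < b by rewrite lt_min ar0 exprn_gt0.
have [z Sz yz] := near_y b b0.
rewrite (_ : x - y = (x - z) - (y - z)); last by rewrite opprB addrA subrK.
rewrite innerBr (le_trans (ler_normB _ _))// [a]splitr rmorphD.
have arE : a / (2 * (r + 1)) * r <= a / 2.
  rewrite invfM mulrA -mulrA ler_piMr//; first by rewrite divr_ge0// ltW.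
  by rewrite mulrC ler_pdivrMr// mul1r lerDl.
apply: lerD.
  rewrite -ler_sqr ?nnegrE//; last by rewrite (lecR 0) divr_ge0// ltW.
  rewrite (le_trans (orth _ _ _ Cc Sz))// cE -!rmorphXn -rmorphM/= lecR.
  apply: (@le_trans _ _ ((a / (2 * (r + 1)) * r) ^+ 2)).
    by rewrite exprMn ler_wpM2r ?exprn_ge0// ge_min lexx orbT.
  by rewrite ler_sqr ?nnegrE//; [exact: mulr_ge0 (ltW ar0) r0|rewrite divr_ge0// ltW].
rewrite (le_trans (cauchy_schwarz _ _))// (le_trans (ler_wpM2l _ yz))// cE.
rewrite -rmorphM lecR mulrC (le_trans _ arE)// ler_wpM2r//.
by rewrite ge_min lexx.
Qed.

End Density.

(** * Extension of Gram-preserving families to isometries *)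

Section IsometryExtension.
Variables (R : realType) (T : Type).
Implicit Types s : seq (R[i] * T).

Definition lincomb (V : lmodType R[i]) (f : T -> V) s : V :=
  \sum_(p <- s) p.1 *: f p.2.

Lemma lincomb_linear (V : lmodType R[i]) (f : T -> V) a s s' :
  lincomb f ([seq (a * p.1, p.2) | p <- s] ++ s') = a *: lincomb f s + lincomb f s'.
Proof.
rewrite /lincomb big_cat big_map/= scaler_sumr; congr (_ + _).
by apply: eq_bigr => p _; rewrite scalerA.
Qed.

Variables (H1 H2 : hilbertType R) (f : T -> H1) (g : T -> H2).
Hypothesis fg : forall t t', inner (f t) (f t') = inner (g t) (g t').
Hypothesis f_total : forall y, (forall t, inner (f t) y = 0) -> y = 0.

Let norm_lincomb s : `|lincomb g s| = `|lincomb f s|.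
Proof.
apply/eqP; rewrite -(@eqrXn2 _ 2)// -!inner_norm; apply/eqP.
rewrite !inner_suml; apply: eq_bigr => p _; rewrite !inner_sumr.
by apply: eq_bigr => q _; rewrite !innerZl !innerZr fg.
Qed.

Let dense (x : H1) (e : R) : 0 < e -> exists s, `|x - lincomb f s| <= e%:C%C.
Proof.
move=> e0; have [||y yC|_ [s _ <-] xs] := @total_dense R H1 (range (lincomb f)) _ _ _ x e e0.
- by exists [::]; rewrite // /lincomb big_nil.
- move=> a _ _ [s _ <-] [s' _ <-].
  by exists ([seq (a * p.1, p.2) | p <- s] ++ s'); rewrite // lincomb_linear.
- apply: f_total => t; apply: yC; exists [:: (1, t)] => //.
  by rewrite /lincomb big_seq1 scale1r.
- by exists s.
Qed.

(** The graph of the extension: the closure in H1 * H2 of the pairs of linear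
    combinations with the same coefficients. *)
Let rel (x : H1) (y : H2) := forall e : R, 0 < e ->
  exists s, `|x - lincomb f s| <= e%:C%C /\ `|y - lincomb g s| <= e%:C%C.

Let rel_norm x y : rel x y -> `|y| = `|x|.
Proof.
move=> xy.
apply/eqP; rewrite -subr_eq0; apply/eqP; apply: (@norm_eq0_of_le R R[i]^o) => e e0.
have e20 : 0 < e / 2 by rewrite divr_gt0.
have [s [xs ys]] := xy _ e20; rewrite [e]splitr rmorphD.
rewrite -(subrK `|lincomb g s| `|y|) -addrA (le_trans (ler_normD _ _))//.
rewrite lerD// ?(le_trans (ler_dist_dist _ _))// norm_lincomb.
by rewrite (le_trans (ler_dist_dist _ _))// distrC.
Qed.

Let rel_linear a x x' y y' : rel x y -> rel x' y' -> rel (a *: x + x') (a *: y + y').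
Proof.
move=> xy xy' e e0; pose r := Normc.normc a.
have aE : `|a| = r%:C%C by [].
have r0 : 0 <= r by rewrite -(lecR 0) -aE normr_ge0.
have r10 : 0 < r + 1 by rewrite ltr_wpDl.
have d0 : 0 < e / (r + 1) by rewrite divr_gt0.
have [s [xs ys]] := xy _ d0; have [s' [xs' ys']] := xy' _ d0.
exists ([seq (a * p.1, p.2) | p <- s] ++ s'); rewrite !lincomb_linear.
have bound (V : normedModType R[i]) (u u' v v' : V) :
    `|u - v| <= (e / (r + 1))%:C%C -> `|u' - v'| <= (e / (r + 1))%:C%C ->
    `|a *: u + u' - (a *: v + v')| <= e%:C%C.
  move=> uv uv'; rewrite opprD addrACA -scalerBr (le_trans (ler_normD _ _))//.
  rewrite normrZ aE -[X in _ <= X%:C%C](divfK (negbT (gt_eqF r10))).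
  rewrite mulrDr mulr1 rmorphD lerD// mulrC rmorphM.
  by rewrite ler_wpM2r// (lecR 0).
by split; apply: bound.
Qed.

Let rel_ex x : exists y, rel x y.
Proof.
pose S (e : R) := [set lincomb g s | s in [set s | `|x - lincomb f s| <= e%:C%C]].
pose F := filter_from [set e : R | 0 < e] S.
have FF : ProperFilter F.
  apply: filter_from_proper; last first.
    by move=> e /= e0; have [s xs] := dense x e0; exists (lincomb g s), s.
  apply: filter_from_filter; first by exists 1; rewrite /= ltr01.
  move=> a b a0 b0; exists (Num.min a b); first by rewrite /= lt_min a0.
  move=> _ [s /= xs <-]; split; exists s => //=; apply: (le_trans xs);
    by rewrite lecR ge_min lexx ?orbT.
have /cvg_ex[y Fy] : cvg F.
  apply: cauchy_cvg; apply/cauchyP => -[a a'].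
  rewrite ltcE/= => /andP[/eqP-> a0]; rewrite complexr0.
  have a20 : 0 < a / 3 by rewrite divr_gt0.
  have [s xs] := dense x a20; exists (lincomb g s); exists (a / 3) => // _ [s' /= xs' <-].
  rewrite -ball_normE/=.
  have -> : lincomb g s - lincomb g s' =
      lincomb g ([seq (-1 * p.1, p.2) | p <- s'] ++ s).
    by rewrite lincomb_linear scaleN1r addrC.
  rewrite norm_lincomb lincomb_linear scaleN1r addrC.
  rewrite -[_ - _](subrKA x) (le_lt_trans (ler_normD _ _))//.
  apply: (@le_lt_trans _ _ ((a / 3)%:C%C + (a / 3)%:C%C)).
    by rewrite lerD// distrC.
  rewrite -rmorphD ltcR; lra.

exists y => e e0; have e0' : 0 < e%:C%C :> R[i] by rewrite (ltcR 0).
have [b b0 bS] := Fy _ (nbhsx_ballx y _ e0').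
have m0 : 0 < Num.min b e by rewrite lt_min b0.
have [s xs] := dense x m0; exists s; split.
  by apply: (le_trans xs); rewrite lecR ge_min lexx orbT.
have : S b (lincomb g s).
  by exists s => //=; apply: (le_trans xs); rewrite lecR ge_min lexx.
by move=> /bS; rewrite -ball_normE => /ltW.
Qed.

(** Equal Gram matrices make the map from combinations of the f t to those of
    the g t isometric; it extends to all of H1 because the f t span a dense
    subspace and H2 is complete. *)
Lemma isometry_extension : exists2 M : bop H1 H2,
  (forall x, `|M x| = `|x|) & forall t, M (f t) = g t.
Proof.
have /choice[m mP] := rel_ex.
have rel_fun x y y' : rel x y -> rel x y' -> y = y'.
  move=> xy xy'; apply/eqP; rewrite -subr_eq0 -normr_eq0.
  have := rel_norm (rel_linear (-1) xy' xy).
  by rewrite !scaleN1r addNr normr0 addrC => ->.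
have lm : linear m.
  by move=> a x x'; apply: rel_fun (mP _) _; exact: rel_linear.
have bm : m \in @bounded_linear R H1 H2.
  apply/asboolP; split=> //; exists 1 => x.
  by rewrite mul1r (rel_norm (mP x)).
exists (Bop bm) => [x|t] /=; first exact: rel_norm.
apply: (rel_fun (f t)) (mP _) _ => e e0; exists [:: (1, t)].
by rewrite /lincomb !big_seq1 !scale1r !subrr !normr0 (lecR 0) ltW.
Qed.

End IsometryExtension.

(** * Limits of unordered sums *)

Section Nets.
Variable R : realType.
Local Notation C := R[i]^o.

Lemma le_of_add_eps (a b : R[i]) : a \is Num.real -> b \is Num.real ->
  (forall e : R, 0 < e -> a <= b + e%:C%C) -> a <= b.
Proof.
move=> aR bR ab; rewrite -(RRe_real aR) -(RRe_real bR) lecR.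
apply/ler_addgt0Pr => e e0; rewrite -lecR rmorphD.
by have := ab e e0; rewrite -{1}(RRe_real aR) -{1}(RRe_real bR).
Qed.

Lemma norm_lim_le (V : normedModType R[i]) (T : Type) (F : set_system T)
    (FF : ProperFilter F) (f : T -> V) (l : V) (M : R) :
  f @ F --> l -> (\forall t \near F, `|f t| <= M%:C%C) -> `|l| <= M%:C%C.
Proof.
move=> fl fM; apply: le_of_add_eps; rewrite ?normr_real ?complex_real// => e e0.
have e0' : 0 < e%:C%C :> R[i] by rewrite (ltcR 0).
have /cvgrPdist_le/(_ _ e0') lf := fl.
have [t [tM te]] := filter_ex (filterI fM lf).
by rewrite -(subrK (f t) l) addrC (le_trans (ler_normD _ _))// lerD.
Qed.

Lemma inner_cvg (V : innerProductType R) (T : Type) (F : set_system T)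
    (FF : Filter F) (f : T -> V) (l y : V) :
  f @ F --> l -> (fun t => inner y (f t) : C) @ F --> (inner y l : C).
Proof.
move=> fl; apply/(@cvgrPdist_le _ C) => e e0.
have y0 : 0 < `|y| + 1 by rewrite ltr_wpDl.
have e1 : 0 < e / (`|y| + 1) by rewrite divr_gt0.
have /cvgrPdist_le/(_ _ e1) := fl; apply: filterS => t lt.
rewrite -innerBr (le_trans (cauchy_schwarz _ _))//.
rewrite (@le_trans _ _ ((`|y| + 1) * `|l - f t|))//.
  by rewrite ler_wpM2r// lerDl.
by rewrite mulrC -ler_pdivlMr.
Qed.

Variable I : choiceType.

Lemma partial_sum_unique (f : I -> C) (a b : C) :
  partial_sum f @ totally --> a -> partial_sum f @ totally --> b -> a = b.
Proof.
move=> fa fb; exact: (@norm_cvg_unique _ C (partial_sum f @ totally) _ a b fa fb).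
Qed.

Lemma inner_partial_sum (V : innerProductType R) (xi : I -> V) (y : V) A :
  inner y (partial_sum xi A) = partial_sum (fun i => inner y (xi i) : C) A.
Proof. by rewrite !partial_sumE inner_sumr. Qed.

Lemma inner_partial_sum_cvg (V : innerProductType R) (xi : I -> V) (l y : V) :
  partial_sum xi @ totally --> l ->
  partial_sum (fun i => inner y (xi i) : C) @ totally --> (inner y l : C).
Proof.
move=> /(inner_cvg _ (y := y)).
by under eq_fun do rewrite inner_partial_sum.
Qed.

Lemma partial_sum_le_lim (f : I -> C) (l : C) A : (forall i, 0 <= f i) ->
  partial_sum f @ totally --> l -> partial_sum f A <= `|l|.
Proof.
move=> f0 fl; apply: le_of_add_eps; rewrite ?normr_real//.
  by rewrite ger0_real// partial_sum_ge0.
move=> e e0; have e0' : 0 < e%:C%C :> R[i] by rewrite (ltcR 0).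
have /(@cvgrPdist_le _ C)/(_ _ e0')[B _ /(_ (A `|` B)%fset (fsubsetUr _ _)) /= h] := fl.
rewrite (le_trans (partial_sum_incl f0 (fsubsetUl A B)))//.
rewrite -[leLHS]ger0_norm ?partial_sum_ge0//.
rewrite -[X in `|X|](subrK l) (le_trans (ler_normD _ _))// addrC lerD2l.
by rewrite distrC.
Qed.

Lemma partial_sum_tail (f : I -> C) (M : R[i]) (e : R) : (forall i, 0 <= f i) ->
  (forall A, partial_sum f A <= M) -> 0 < e ->
  exists A, forall B, (A `<=` B)%fset -> partial_sum f B - partial_sum f A <= e%:C%C.
Proof.
move=> f0 fM e0.
have /(partial_sum_cvgP f0)/cvg_ex[l fl] : exists M, forall A, partial_sum f A <= M.
  by exists M.
have e0' : 0 < (e / 2)%:C%C :> R[i] by rewrite (ltcR 0) divr_gt0.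
have /(@cvgrPdist_le _ C)/(_ _ e0')[A _ Al] := fl.
exists A => B AB; rewrite -[leLHS]ger0_norm ?subr_ge0 ?partial_sum_incl//.
rewrite -(subrKA l) (le_trans (ler_normD _ _))// [e]splitr rmorphD lerD//.
  by rewrite distrC; exact: Al.
by apply: Al => /=.
Qed.

End Nets.

(** * Rank-one operators and finite-rank projections *)

Section RankOne.
Variables (R : realType) (G : hilbertType R).
Implicit Types (u v x y : G) (b P : 'B(G)).

Fact rank1_subproof u v : (fun x => inner v x *: u) \in @bounded_linear R G G.
Proof.
apply/asboolP; split=> [a x y|].
  by rewrite innerDr innerZr scalerDl scalerA.
exists (complex.Re `|u| * complex.Re `|v|) => x.
rewrite normrZ rmorphM/= !RRe_real ?normr_real// mulrC -mulrA.
by rewrite ler_wpM2l// cauchy_schwarz.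
Qed.

Definition rank1 u v : 'B(G) := Bop (rank1_subproof u v).

Lemma rank1E u v x : rank1 u v x = inner v x *: u. Proof. by []. Qed.

Lemma mul_rank1 b u v : b * rank1 u v = rank1 (b u) v.
Proof. by apply: bopP => x; rewrite bopM !rank1E linearZ. Qed.

Definition finite_rank (s : seq (G * G)) : 'B(G) := \sum_(p <- s) rank1 p.1 p.2.

(** Gram-Schmidt: P is extended by the rank-one projection onto the line of
    w := v - P v.  The identity <P x, y - P y> = 0, which says that P is an
    orthogonal projection, is what the induction carries; it makes 1 - P a
    contraction by Pythagoras. *)
Lemma projection_fixing (xs : seq G) : exists s,
  (forall x, x \in xs -> finite_rank s x = x) /\
  (forall x, `|x - finite_rank s x| <= `|x|).
Proof.
suff [s [sxs orth]] : exists s, (forall x, x \in xs -> finite_rank s x = x) /\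
    (forall x y, inner (finite_rank s x) (y - finite_rank s y) = 0).
  exists s; split=> // x; set p := finite_rank s in orth *.
  rewrite -ler_sqr ?nnegrE// -[X in _ <= `|X| ^+ 2](subrK (p x) x) [X in _ <= `|X| ^+ 2]addrC.
  rewrite -[X in _ <= `|_ + X| ^+ 2]scale1r.
  rewrite norm_addZ (inner_conj (x - p x)) !orth rmorph0 !mulr0 !add0r.
  by rewrite normr1 expr1n mul1r lerDr exprn_ge0.
elim: xs => [|v xs [s [sxs orth]]].
  exists [::]; split=> // x y; rewrite /finite_rank big_nil.
  by rewrite [X in inner X _](_ : _ = 0)// inner0l.
(* When w = 0 the inverse is 0 by convention, and the added term vanishes. *)
pose w := v - finite_rank s v; pose u := (`|w| ^+ 2)^-1 *: w.
have PE x : finite_rank ((u, w) :: s) x = inner w x *: u + finite_rank s x.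
  by rewrite /finite_rank big_cons.
have wP x : inner w (finite_rank s x) = 0 by rewrite inner_conj orth rmorph0.
have wu : inner w u *: w = w.
  have [->|w0] := eqVneq w 0; first by rewrite scaler0.
  by rewrite innerZr inner_norm mulVf ?scale1r// expf_neq0// normr_eq0.
exists ((u, w) :: s); split=> [x|x y].
  rewrite inE PE => /orP[/eqP->|xs'].
    rewrite -[RHS](subrK (finite_rank s v) v); congr (_ + _).
    have -> : inner w v = inner w w.
      by rewrite -[v in LHS](subrK (finite_rank s v) v) innerDr wP addr0.
    by rewrite -[RHS]wu innerZr !scalerA mulrC.
  by rewrite -{1}(sxs x xs') wP scale0r add0r sxs.
have Pw z : inner (finite_rank s z) w = 0 by rewrite orth.
have cR : (`|w| ^+ 2)^* = `|w| ^+ 2 by rewrite -inner_norm -inner_conj.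
have := orth x y; rewrite innerBr => /eqP; rewrite subr_eq0 => /eqP Pxy.
(* The definition of w is forgotten, so that the expansion stops at w. *)
move: cR Pw wP; rewrite !PE /u; clear u PE wu; move: w => w cR Pw wP.
rewrite !(innerDl, innerBr, innerDr, innerZl, innerZr).
rewrite Pw !wP Pxy inner_norm.
rewrite fmorphV/= cR.
have [->|w0] := eqVneq w 0; first by rewrite !inner0l normr0; ring.
by field; rewrite normr_eq0.
Qed.

End RankOne.

Lemma adjointEr (R : realType) (G H : hilbertType R) (A : bop G H) x y :
  inner y (adjoint A x) = inner (A y) x.
Proof. by rewrite inner_conj adjointE -inner_conj. Qed.

(** * GKSL forms are determined by their values on rank-one operators *)

Section GKSLForms.
Variables (R : realType) (G : hilbertType R).
Implicit Types (u v x y : G) (b P : 'B(G)).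
Local Notation C := R[i]^o.

Lemma GKSL_weak (I : choiceType) (Li : I -> 'B(G)) beta L b x y :
  GKSL_form Li beta L ->
  partial_sum (fun i => inner (Li i y) (b (Li i x)) : C) @ totally -->
  (inner y (L b x) - inner y (b (beta x)) - inner (beta y) (b x) : C).
Proof.
case=> _ /(_ b)[S Sb ->]; rewrite !bopD !bopM !innerDr adjointEr.
rewrite (_ : _ - _ - _ = inner y (S x)); last by ring.
have := inner_partial_sum_cvg (y := y) (Sb x).
by under eq_fun do rewrite !bopM adjointEr.
Qed.

Lemma GKSL_column_bound (I : choiceType) (Li : I -> 'B(G)) (S : 'B(G)) x A :
  strong_sum (fun i => adjoint (Li i) * Li i) S ->
  partial_sum (fun i => `|Li i x| ^+ 2 : C) A <= (opnorm S)%:C%C * `|x| ^+ 2.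
Proof.
move=> /(_ x)/(inner_partial_sum_cvg (y := x)) Sx.
have {Sx} : partial_sum (fun i => `|Li i x| ^+ 2 : C) @ totally --> (inner x (S x) : C).
  by under eq_fun do rewrite -inner_norm -adjointEr -bopM.
move=> /(partial_sum_le_lim A) h.
rewrite (le_trans (h _))//; first by move=> i; exact: exprn_ge0.
rewrite (le_trans (cauchy_schwarz _ _))// mulrC expr2 mulrA ler_wpM2r//.
exact: opnorm_le.
Qed.

(** A weak form of normality: a projection P that fixes x, beta x and the
    vectors L_i x for i in a large finite set A kills every term of
    <y, L (b (1 - P)) x> but the tail of the sum outside A.  That tail is small
    uniformly in P because 1 - P is a contraction and the series of |L_i x|^2
    and |L_i y|^2 converge. *)
Lemma GKSL_compress_tail (I : choiceType) (Li : I -> 'B(G)) beta L b x y (e : R) :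
  GKSL_form Li beta L -> 0 < e ->
  exists xs : seq G, forall P : 'B(G),
    (forall z, z \in xs -> P z = z) -> (forall z, `|z - P z| <= `|z|) ->
    `|inner y (L (b * (1 - P)) x)| <= e%:C%C.
Proof.
move=> formL e0; have [[S0 colS] _] := formL.
pose f i := `|Li i x| ^+ 2 + `|Li i y| ^+ 2 : C.
have f0 i : 0 <= f i by rewrite addr_ge0// exprn_ge0.
have fM A : partial_sum f A <=
    (opnorm S0)%:C%C * `|x| ^+ 2 + (opnorm S0)%:C%C * `|y| ^+ 2.
  by rewrite partial_sumE big_split/= lerD// -partial_sumE GKSL_column_bound.
have b0 : 0 < opnorm b + 1 by rewrite ltr_wpDl// opnorm_ge0.
have [A tailA] := partial_sum_tail f0 fM (divr_gt0 e0 b0).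
exists [:: x, beta x & [seq Li i x | i <- A]] => P Pxs Pc.
pose c := b * (1 - P).
have cE z : c z = b (z - P z) by [].
have c0 z : z \in [:: x, beta x & [seq Li i x | i <- A]] -> c z = 0.
  by move=> /Pxs Pz; rewrite cE Pz subrr linear0.
have := @GKSL_weak _ _ _ _ c x y formL.
rewrite (c0 x) ?inE ?eqxx// (c0 (beta x)) ?inE ?eqxx ?orbT// !inner0r !subr0 => cv.
apply: (norm_lim_le (V := C) _ cv); exists A => // B AB.
rewrite partial_sumE (le_trans (ler_norm_sum _ _ _))//.
apply: (@le_trans _ _ ((opnorm b)%:C%C * (partial_sum f B - partial_sum f A))).
  rewrite !partial_sumE !(big_fsetID _ (mem A) B)/=.
  rewrite (_ : [fset z in B | z \in A]%fset = A); last first.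
    apply/fsetP => z; rewrite !inE/= andbC; case: (boolP (z \in A)) => //= zA.
    exact: (fsubsetP AB).
  have -> : \sum_(i <- A) `|inner (Li i y) (c (Li i x))| = 0.
    rewrite big_seq big1// => i iA.
    by rewrite (c0 (Li i x)) ?inner0r ?normr0// !inE (map_f (fun i => Li i x)) ?orbT.
  rewrite add0r [X in _ <= _ * X]addrAC subrr add0r.
  rewrite mulr_sumr ler_sum// => i _.
  rewrite (le_trans (cauchy_schwarz _ _))//.
  apply: (@le_trans _ _ (`|Li i y| * ((opnorm b)%:C%C * `|Li i x|))).
    rewrite ler_wpM2l// (le_trans (opnorm_le _ _))// ler_wpM2l//.
      by rewrite (lecR 0) opnorm_ge0.
    exact: Pc.
  rewrite mulrCA ler_wpM2l ?(lecR 0) ?opnorm_ge0//.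
  have xyr : `|Li i y| - `|Li i x| \is Num.real by rewrite rpredB ?normr_real.
  have := sqr_ge0 (complex.Re (`|Li i y| - `|Li i x|)).
  rewrite -ler0c rmorphXn/= RRe_real// => h.
  have xy0 : 0 <= `|Li i y| * `|Li i x| by rewrite mulr_ge0.
  rewrite /f -subr_ge0 (_ : _ - _ = (`|Li i y| - `|Li i x|) ^+ 2 + `|Li i y| * `|Li i x|).
    by rewrite addr_ge0.
  by ring.
apply: (@le_trans _ _ ((opnorm b)%:C%C * (e / (opnorm b + 1))%:C%C)).
  by rewrite ler_wpM2l ?tailA// (lecR 0) opnorm_ge0.
rewrite -rmorphM lecR mulrA ler_pdivrMr// mulrC ler_wpM2l ?ltW//.
by rewrite ltrDl.
Qed.

(** Split b = b P + b (1 - P) with P a finite-rank projection: b P is a sum of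
    rank-one operators, and b (1 - P) contributes arbitrarily little. *)
Lemma GKSL_eq_rank1 (I J : choiceType) (Li : I -> 'B(G)) beta L
    (Kj : J -> 'B(G)) alpha K :
  GKSL_form Li beta L -> GKSL_form Kj alpha K ->
  (forall u v, K (rank1 u v) = L (rank1 u v)) -> K = L.
Proof.
move=> formL formK KL; apply: bopP => b; apply: bopP => x.
apply: inner_separatesr => y; apply/eqP; rewrite -subr_eq0; apply/eqP.
have le_eps (e : R) : 0 < e -> `|inner y (K b x) - inner y (L b x)| <= e%:C%C.
  move=> e0; have e20 : 0 < e / 2 by rewrite divr_gt0.
  have [xs Lxs] := GKSL_compress_tail b x y formL e20.
  have [xs' Kxs'] := GKSL_compress_tail b x y formK e20.
  have [s [sfix scontr]] := projection_fixing (xs ++ xs').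
  set P := finite_rank s in sfix scontr.
  have KLP : K (b * P) = L (b * P).
    rewrite /P /finite_rank mulr_sumr !linear_sum; apply: eq_bigr => p _.
    by rewrite mul_rank1; exact: KL.
  have -> : inner y (K b x) - inner y (L b x) =
      inner y (K (b * (1 - P)) x) - inner y (L (b * (1 - P)) x).
    rewrite !mulrBr !mulr1 !linearB/= KLP.
    transitivity (inner y (K b x - L (b * P) x) - inner y (L b x - L (b * P) x)); last by [].
    by rewrite !innerBr; ring.
  rewrite (le_trans (ler_normB _ _))// [e]splitr rmorphD lerD//.
    by apply: Kxs' => // z zxs; apply: sfix; rewrite mem_cat zxs orbT.
  by apply: Lxs => // z zxs; apply: sfix; rewrite mem_cat zxs.
exact: (@norm_eq0_of_le R C).
Qed.

End GKSLForms.

(** * Square-summable sequences *)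

Section SquareSummableVectors.
Variables (R : realType) (I : choiceType).
Local Notation C := R[i]^o.
Implicit Types z : l2 R I.

Lemma inner_l2_delta i z : inner (l2_delta R i) z = z i.
Proof.
apply: (partial_sum_unique (@l2_inner_cvg R I (l2_delta R i) z)).
apply/(@cvgrPdist_le _ C) => e e0; exists [fset i]%fset => // A /=.
rewrite fsub1set => iA; rewrite partial_sumE (big_fsetD1 i)//= eqxx rmorph1 mul1r.
rewrite big_seq big1 ?addr0 ?subrr ?normr0 ?ltW// => k.
by rewrite !inE => /andP[/negPf-> _]; rewrite rmorph0 mul0r.
Qed.

Lemma l2_conj_subproof z : (fun i => (z i)^*) \in @square_summable R I.
Proof.
have /square_summableP[M zM] := l2_summable z.
apply/square_summableP; exists M => A.
by under eq_fun do rewrite norm_conjC.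
Qed.

Definition l2_conj z : l2 R I := L2 (l2_conj_subproof z).

(** The finite truncation p of z is the orthogonal projection of z onto the
    span of the corresponding basis vectors, so |z - p|^2 = |z|^2 - |p|^2, and
    this is the tail of a convergent series. *)
Lemma l2_expansion z :
  partial_sum (fun i => z i *: l2_delta R i) @ totally --> z.
Proof.
pose p A : l2 R I := partial_sum (fun i => z i *: l2_delta R i) A.
have pE A y : inner (p A) y = partial_sum (fun i => (z i)^* * y i : C) A.
  rewrite /p !partial_sumE inner_suml; apply: eq_bigr => i _.
  by rewrite innerZl inner_l2_delta.
have p_coord A i : i \in A -> p A i = z i.
  move=> iA; rewrite -inner_l2_delta inner_conj pE partial_sumE.
  rewrite (big_fsetD1 i)//= eqxx mulr1 big_seq big1 ?addr0 ?conjCK// => k.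
  by rewrite !inE => /andP[/negPf-> _]; rewrite mulr0.
have pp A : inner (p A) (p A) = inner (p A) z.
  by rewrite !pE !partial_sumE !big_seq; apply: eq_bigr => i iA; rewrite p_coord.
apply/cvgrPdist_le => e e0.
have e20 : 0 < e ^+ 2 by rewrite exprn_gt0.
have /(@cvgrPdist_le _ C)/(_ _ e20)[A _ Az] := @l2_inner_cvg R I z z.
exists A => // B /Az zB; rewrite -ler_sqr ?nnegrE//; last exact: ltW.
rewrite -[partial_sum _ B]/(p B) -inner_norm innerBl !innerBr pp subrr subr0.
rewrite (inner_conj z (p B)) -pp -inner_conj pp pE.
by rewrite (le_trans _ zB)// real_ler_norm// rpredB// ger0_real//;
  [exact: l2_inner_ge0|rewrite -pE -pp inner_norm exprn_ge0].
Qed.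

End SquareSummableVectors.

(** Polarization, with the coefficients 1 and i. *)
Lemma isometry_inner (R : realType) (H1 H2 : innerProductType R) (M : bop H1 H2) :
  (forall x, `|M x| = `|x|) -> forall x y, inner (M x) (M y) = inner x y.
Proof.
move=> isoM x y.
have add_eq a : a * inner (M x) (M y) + a^* * inner (M y) (M x) =
    a * inner x y + a^* * inner y x.
  have := norm_addZ (M x) (M y) a; rewrite -linearZ -linearD !isoM norm_addZ.
  by move=> /addrI/addIr ->.
have h1 := add_eq 1; have hi := add_eq 'i%C.
rewrite rmorph1 !mul1r in h1.
have ci : ('i%C : R[i])^* = - 'i%C.
  by rewrite /Num.conj/=; apply/eqP; rewrite eq_complex/= oppr0 !eqxx.
rewrite ci !mulNr -!mulrBr in hi.
have i0 : ('i%C : R[i]) != 0.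
  by rewrite eq_complex/= oner_eq0 andbF.
move/(mulfI i0): hi => hi.
have : 2 * inner (M x) (M y) = 2 * inner x y.
  have := congr2 +%R h1 hi; rewrite !mulr_natl !mulr2n.
  by rewrite addrACA addrN addr0 => ->; rewrite addrACA addrN addr0.
by apply: mulfI; rewrite pnatr_eq0.
Qed.

(** * Coefficient vectors of a family of operators *)

Section Coefficients.
Variables (R : realType) (G : hilbertType R) (I : choiceType).
Variables (Li : I -> 'B(G)) (S : 'B(G)).
Hypothesis Sconv : strong_sum (fun i => adjoint (Li i) * Li i) S.
Local Notation C := R[i]^o.
Implicit Types (u v x y : G) (z : l2 R I).

Let coeff_sum_le v x A : partial_sum (fun i => `|inner v (Li i x)| ^+ 2 : C) A <=
  (`|v| * ((Num.sqrt (opnorm S))%:C%C * `|x|)) ^+ 2.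
Proof.
rewrite exprMn exprMn -rmorphXn/= sqr_sqrtr ?opnorm_ge0//.
apply: (@le_trans _ _ (`|v| ^+ 2 * partial_sum (fun i => `|Li i x| ^+ 2 : C) A)).
  rewrite !partial_sumE mulr_sumr ler_sum// => i _.
  by rewrite -exprMn ler_sqr ?nnegrE// ?mulr_ge0// cauchy_schwarz.
by rewrite ler_wpM2l ?exprn_ge0//; exact: GKSL_column_bound.
Qed.

Fact coeff_vec_subproof v x : (fun i => inner v (Li i x)) \in @square_summable R I.
Proof. by apply/square_summableP; eexists=> A; exact: coeff_sum_le. Qed.

(** The strong convergence of the sum of adjoint L_i composed with L_i turns
    matrix elements into vectors of l2: this replaces the element of the
    Hilbert module l2 (x) B(G) given by the whole family. *)
Definition coeff_vec v x : l2 R I := L2 (coeff_vec_subproof v x).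

Lemma coeff_vec_norm v x :
  `|coeff_vec v x| <= `|v| * ((Num.sqrt (opnorm S))%:C%C * `|x|).
Proof.
apply: l2_norm_le; last exact: coeff_sum_le.
by rewrite !mulr_ge0// (lecR 0) sqrtr_ge0.
Qed.

Lemma coeff_vec_linear v a x y :
  coeff_vec v (a *: x + y) = a *: coeff_vec v x + coeff_vec v y.
Proof.
apply: l2_ext => i; rewrite /= linearP innerDr innerZr.
by [].
Qed.

Lemma coeff_vec_conj_linear a u v x :
  coeff_vec (a *: u + v) x = a^* *: coeff_vec u x + coeff_vec v x.
Proof. by apply: l2_ext => i; rewrite /= innerDl innerZl. Qed.

(** The operator Y is obtained weakly, by applying the Riesz theorem to
    x |-> <z, coeff_vec v x>.  The same bound, applied to the difference between
    z and its truncations, gives the strong (even norm) convergence. *)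
Lemma strong_sum_coeff z : exists2 Y : 'B(G),
  strong_sum (fun i => (z i)^* *: Li i) Y &
  forall v x, inner v (Y x) = inner z (coeff_vec v x).
Proof.
pose m := complex.Re `|z| * Num.sqrt (opnorm S).
have mE w v x : `|inner w (coeff_vec v x)| <=
    `|w| * (Num.sqrt (opnorm S))%:C%C * `|v| * `|x|.
  rewrite (le_trans (cauchy_schwarz _ _))// -!mulrA ler_wpM2l//.
  by rewrite (le_trans (coeff_vec_norm _ _))// mulrCA.
have /choice[t tP] v : exists w, forall x, inner z (coeff_vec v x) = inner w x.
  apply: (@riesz R G (fun x => inner z (coeff_vec v x)) _ (m * complex.Re `|v|)).
    by move=> a x y; rewrite coeff_vec_linear innerDr innerZr.
  by move=> x; rewrite !rmorphM/= !RRe_real ?normr_real// mE.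
have tb : t \in @bounded_linear R G G.
  apply/asboolP; split=> [a u v|].
    apply: inner_separates => x.
    by rewrite innerDl innerZl -!tP coeff_vec_conj_linear innerDr innerZr.
  exists m => v; rewrite rmorphM/= RRe_real ?normr_real//.
  have [->|v0] := eqVneq (t v) 0.
    by rewrite normr0 !mulr_ge0// (lecR 0) sqrtr_ge0.
  have tv0 : 0 < `|t v| by rewrite normr_gt0.
  rewrite -(ler_pM2r tv0) -expr2 -inner_norm -tP.
  rewrite (le_trans _ (mE z v (t v)))// ger0_norm// tP inner_norm exprn_ge0//.
have YE v x : inner v (adjoint (Bop tb) x) = inner z (coeff_vec v x).
  by rewrite adjointEr /= tP.
exists (adjoint (Bop tb)) => // x; set Y := adjoint _ in YE *.
have YA v A : inner v (partial_sum (fun i => ((z i)^* *: Li i) x) A) =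
    inner (partial_sum (fun i => z i *: l2_delta R i) A) (coeff_vec v x).
  rewrite !partial_sumE inner_suml inner_sumr; apply: eq_bigr => i _.
  by rewrite bopZ innerZr innerZl inner_l2_delta.
have dist A : `|Y x - partial_sum (fun i => ((z i)^* *: Li i) x) A| <=
    `|z - partial_sum (fun i => z i *: l2_delta R i) A| *
    (Num.sqrt (opnorm S))%:C%C * `|x|.
  set w := Y x - _.
  have [->|w0] := eqVneq w 0.
    by rewrite normr0 !mulr_ge0// (lecR 0) sqrtr_ge0.
  have w0' : 0 < `|w| by rewrite normr_gt0.
  have ww : inner w w = inner (z - partial_sum (fun i => z i *: l2_delta R i) A) (coeff_vec w x).
    by rewrite {2}/w innerBr YE YA -innerBl.
  rewrite -(ler_pM2r w0') -expr2 -inner_norm -[X in _ <= X]mulrA [ `|x| * _]mulrC mulrA.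
  by rewrite (le_trans _ (mE _ _ _))// -ww ger0_norm// inner_norm exprn_ge0.
pose k := (Num.sqrt (opnorm S))%:C%C * `|x| + 1.
have k0 : 0 < k by rewrite ltr_wpDl// mulr_ge0// (lecR 0) sqrtr_ge0.
apply/cvgrPdist_le => e e0; have ek0 : 0 < e / k by rewrite divr_gt0.
have /cvgrPdist_le/(_ _ ek0) := @l2_expansion R I z; apply: filterS => A zA.
rewrite (le_trans (dist A))// -mulrA.
rewrite (le_trans (ler_wpM2r _ zA))//; first by rewrite mulr_ge0// (lecR 0) sqrtr_ge0.
rewrite mulrAC ler_pdivrMr// ler_wpM2l//; first exact: ltW.
by rewrite lerDl.
Qed.

Lemma inner_strong_sum z (Y : 'B(G)) :
  strong_sum (fun i => (z i)^* *: Li i) Y ->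
  forall v x, inner v (Y x) = inner z (coeff_vec v x).
Proof.
move=> zY v x; have [Y' zY' <-] := strong_sum_coeff z.
by rewrite (norm_cvg_unique (zY x) (zY' x)).
Qed.

(** On a rank-one operator the sum over i splits into a product of matrix
    elements, that is, into a scalar product of coefficient vectors. *)
Lemma GKSL_rank1 beta L u v x y : GKSL_form Li beta L ->
  inner y (L (rank1 u v) x) = inner (coeff_vec u y) (coeff_vec v x) +
    inner y u * inner v (beta x) + inner (beta y) u * inner v x.
Proof.
move=> formL.
have := @GKSL_weak _ _ _ _ _ _ (rank1 u v) x y formL.
rewrite (_ : (fun i => _) = fun i => (coeff_vec u y i)^* * coeff_vec v x i : C).
  move=> /(partial_sum_unique (@l2_inner_cvg R I _ _)).
  have -> : l2_inner (coeff_vec u y) (coeff_vec v x) = inner (coeff_vec u y) (coeff_vec v x).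
    by [].
  move=> ->.
  by rewrite !rank1E !innerZr; ring.
by apply/funext => i; rewrite rank1E innerZr mulrC (inner_conj _ u).
Qed.

End Coefficients.

(** * Derivation terms and minimality *)

Section Rigidity.
Variables (R : realType) (G : hilbertType R).
Implicit Types (u v x y e : G) (D : 'B(G)).

(** The hypothesis is that b D + D^* b vanishes for all rank-one b.  With
    u = y = e it says that <v, D x> is a fixed multiple of <v, x>, and with all
    vectors equal to e that the factor is purely imaginary. *)
Lemma skew_derivation_scalar D e : inner e e = 1 ->
  (forall u v x y, inner y u * inner v (D x) + inner (D y) u * inner v x = 0) ->
  exists h : R, D = ('i%C * h%:C%C) *: (1 : 'B(G)).
Proof.
move=> e1 skew; pose c := inner e (D e).
have De : inner (D e) e = c^* by rewrite inner_conj.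
have cc : c + c^* = 0 by have := skew e e e e; rewrite e1 De mul1r mulr1.
have cE : c = 'i%C * (complex.Im c)%:C%C.
  rewrite [LHS]complexE -[RHS]add0r; congr (_ + _).
  have := congr1 (@complex.Re R) cc; case: c {De cc} => a b /= /eqP.
  rewrite -mulr2n mulrn_eq0 /= => /eqP ->; by [].
exists (complex.Im c); rewrite -cE; apply: bopP => x.
apply: inner_separatesr => v; rewrite bopZ bop1 innerZr.
have /eqP := skew e v x e; rewrite e1 mul1r De addr_eq0 => /eqP ->.
by rewrite -mulNr; congr (_ * _); apply/esym/eqP; rewrite -addr_eq0 cc.
Qed.

End Rigidity.

Section Minimal.
Variables (R : realType) (G : hilbertType R) (I : choiceType).
Variables (Li : I -> 'B(G)) (S : 'B(G)).
Hypothesis Sconv : strong_sum (fun i => adjoint (Li i) * Li i) S.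
Hypothesis Lmin : GKSL_minimal Li.
Local Notation l := (coeff_vec Sconv).

(** On the zero space the identity operator is 0, a nontrivial relation. *)
Lemma GKSL_minimal_unit_vector : exists e : G, inner e e = 1.
Proof.
have [x x0] : exists x : G, x != 0.
  apply: contrapT => /forallNP G0.
  have x0 (x : G) : x = 0 by apply/eqP/negPn/negP/G0.
  have [] := @Lmin 1 0 0.
  - move=> x; apply/cvgrPdist_le => e e0; exists fset0 => // A _ /=.
    by rewrite (x0 (_ - _)) normr0 ltW.
  - by apply: bopP => x; rewrite [LHS]x0 [RHS]x0.
  by move=> /eqP; rewrite oner_eq0.
exists (`|x|^-1 *: x); rewrite inner_norm normrZ normfV normr_id mulVf ?expr1n//.
by rewrite normr_eq0.
Qed.

(** Minimality is totality of coefficient vectors: orthogonality of z to the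
    vectors l v x - <v, x> l e e says that the sum of conj(z_i) L_i is a scalar
    operator, so that conj(z) gives a linear relation between the identity and
    the L_i. *)
Lemma GKSL_minimal_total e (z : l2 R I) : inner e e = 1 ->
  (forall v x, inner (l v x - inner v x *: l e e) z = 0) -> z = 0.
Proof.
move=> e1 zl; have [Y zY YE] := strong_sum_coeff Sconv z.
pose c := inner e (Y e).
have Yc : Y = c *: (1 : 'B(G)).
  apply: bopP => x; apply: inner_separatesr => v.
  rewrite bopZ bop1 innerZr /c !YE; apply/eqP; rewrite -subr_eq0 mulrC -innerZr -innerBr.
  by rewrite inner_conj zl rmorph0.
have [|_ z0] := @Lmin (- c) (l2_conj z) Y zY.
  by rewrite Yc -scalerDl addNr scale0r.
by apply: l2_ext => i; apply: (fmorph_inj (@Num.conj R[i])); rewrite rmorph0; exact: z0.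
Qed.

End Minimal.

(** * Comparison of two GKSL forms *)

Section Comparison.
Variables (R : realType) (G : hilbertType R) (I J : choiceType).
Variables (L K : 'B('B(G))) (Li : I -> 'B(G)) (beta : 'B(G)).
Variables (Kj : J -> 'B(G)) (alpha : 'B(G)).
Variables (SL SK : 'B(G)).
Hypothesis SLconv : strong_sum (fun i => adjoint (Li i) * Li i) SL.
Hypothesis SKconv : strong_sum (fun j => adjoint (Kj j) * Kj j) SK.
Hypothesis formL : GKSL_form Li beta L.
Hypothesis formK : GKSL_form Kj alpha K.
Local Notation l := (coeff_vec SLconv).
Local Notation k := (coeff_vec SKconv).
Implicit Types (u v x y e : G).

(** The j-th row of M is the conjugate of the vector adjoint M (delta_j), so the
    j-th coordinate of the first equation is the matrix element between v and x
    of the second one. *)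
Lemma coeff_vec_row (eta' : l2 R J) (M : bop (l2 R I) (l2 R J)) :
  (forall v x, k v x = inner v x *: eta' + M (l v x)) <->
  (forall j, exists2 S : 'B(G), strong_sum (fun i => l2_entry M j i *: Li i) S &
     Kj j = eta' j *: (1 : 'B(G)) + S).
Proof.
have rowE j i : l2_entry M j i = (adjoint M (l2_delta R j) i)^*.
  by rewrite -inner_l2_delta -inner_conj adjointE inner_l2_delta.
have fE j : (fun i => l2_entry M j i *: Li i) =
    fun i => (adjoint M (l2_delta R j) i)^* *: Li i.
  by apply/funext => i; rewrite rowE.
split=> [kE j|KE v x].
  have [S jS SE] := strong_sum_coeff SLconv (adjoint M (l2_delta R j)).
  exists S; rewrite ?fE//; apply: bopP => x; apply: inner_separatesr => v.
  rewrite bopD bopZ bop1 innerDr innerZr SE adjointE inner_l2_delta mulrC.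
  by have := congr1 (fun w : l2 R J => w j) (kE v x).
apply: l2_ext => j; have [S] := KE j; rewrite fE => /inner_strong_sum SE KjE.
rewrite /= KjE bopD bopZ bop1 innerDr innerZr (SE _ SLconv) adjointE inner_l2_delta.
by rewrite mulrC.
Qed.

(** The contribution of the K_j to K on rank-one operators, in terms of that of
    the L_i.  The cross terms are <eta', M l> = <adjoint M eta', l>, which is a
    matrix element of the operator Y. *)
Lemma coeff_vec_gram (eta' : l2 R J) (M : bop (l2 R I) (l2 R J)) (Y : 'B(G)) :
  (forall w, `|M w| = `|w|) ->
  (forall v x, k v x = inner v x *: eta' + M (l v x)) ->
  strong_sum (fun i => ((- adjoint M eta') i)^* *: Li i) Y ->
  forall u v x y, inner (k u y) (k v x) = inner (l u y) (l v x) +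
    inner y u * inner v x * inner eta' eta' -
    inner y u * inner v (Y x) - inner (Y y) u * inner v x.
Proof.
move=> isoM kE /inner_strong_sum YE u v x y.
have {}YE w z : inner eta' (M (l w z)) = - inner w (Y z).
  by rewrite (YE _ SLconv) innerNl adjointE opprK.
have YE' w z : inner (M (l w z)) eta' = - inner (Y z) w.
  by rewrite inner_conj YE rmorphN/= -inner_conj.
rewrite !kE !(innerDl, innerDr, innerZl, innerZr) isometry_inner// YE YE'.
by rewrite -inner_conj; ring.
Qed.

Lemma GKSL_rank1_eq :
  (forall u v, K (rank1 u v) = L (rank1 u v)) <->
  (forall u v x y, inner (k u y) (k v x) + inner y u * inner v (alpha x) +
     inner (alpha y) u * inner v x =
   inner (l u y) (l v x) + inner y u * inner v (beta x) +
     inner (beta y) u * inner v x).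
Proof.
split=> [KL u v x y|KL u v].
  by rewrite -(GKSL_rank1 SLconv u v x y formL) -(GKSL_rank1 SKconv u v x y formK) KL.
apply: bopP => x; apply: inner_separatesr => y.
by rewrite (GKSL_rank1 SLconv _ _ _ _ formL) (GKSL_rank1 SKconv _ _ _ _ formK) KL.
Qed.

(** Subtracting from the coefficient vectors their values at (e, e), weighted by
    <v, x>, removes the contribution of alpha and beta: what remains are two
    families with the same Gram matrix, the first of which is total. *)
Lemma GKSL_eq_isometry : GKSL_minimal Li -> K = L ->
  exists (eta' : l2 R J) (M : bop (l2 R I) (l2 R J)),
    (forall w, `|M w| = `|w|) /\
    forall v x, k v x = inner v x *: eta' + M (l v x).
Proof.
move=> Lmin KL; have [e e1] := GKSL_minimal_unit_vector Lmin.
have /GKSL_rank1_eq gram : forall u v, K (rank1 u v) = L (rank1 u v) by rewrite KL.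
pose f (t : G * G) := l t.1 t.2 - inner t.1 t.2 *: l e e.
pose g (t : G * G) := k t.1 t.2 - inner t.1 t.2 *: k e e.
have fg s t : inner (f s) (f t) = inner (g s) (g t).
  case: s t => [u y] [v x]; rewrite /f /g /=.
  rewrite !(innerBl, innerBr) !(innerZl, innerZr) -inner_conj.
  have gramE a b c d : inner (k a b) (k c d) = inner (l a b) (l c d) +
      inner b a * inner c (beta d) + inner (beta b) a * inner c d -
      inner b a * inner c (alpha d) - inner (alpha b) a * inner c d.
    transitivity (inner (k a b) (k c d) + inner b a * inner c (alpha d) +
        inner (alpha b) a * inner c d - inner b a * inner c (alpha d) -
        inner (alpha b) a * inner c d); first by ring.
    by rewrite gram.
  by rewrite !gramE e1; ring.
have f_total z : (forall t, inner (f t) z = 0) -> z = 0.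
  move=> fz; apply: (GKSL_minimal_total (Sconv := SLconv) Lmin e1) => v x.
  exact: (fz (v, x)).
have [M isoM MP] := isometry_extension fg f_total.
exists (k e e - M (l e e)), M; split=> // v x.
have := MP (v, x); rewrite /f /g /= linearB linearZ/= => {}MP.
by rewrite scalerBr -addrA [- _ + _]addrC MP addrC subrK.
Qed.

End Comparison.

Theorem theorem1p4 (R : realType) (G : hilbertType R) (I J : choiceType)
    (L K : 'B('B(G)))
    (Li : I -> 'B(G)) (beta : 'B(G)) (Kj : J -> 'B(G)) (alpha : 'B(G))
    (L_generator : generates_CP_semigroup L)
    (L_form : GKSL_form Li beta L)
    (L_minimal : GKSL_minimal Li)
    (K_generator : generates_CP_semigroup K)
    (K_form : GKSL_form Kj alpha K) :
  K = L <->
  exists (eta' : l2 R J) (M : bop (l2 R I) (l2 R J)) (h : R),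
    (forall x, `|M x| = `|x|) /\
    let eta : l2 R I := - adjoint M eta' in
    let gamma : R[i] := 'i%C * h%:C%C - 2^-1 * inner eta' eta' in
    (exists2 S : 'B(G), strong_sum (fun i => (eta i)^* *: Li i) S &
       alpha = beta + gamma *: (1 : 'B(G)) + S) /\
    (forall j, exists2 S : 'B(G), strong_sum (fun i => l2_entry M j i *: Li i) S &
       Kj j = eta' j *: (1 : 'B(G)) + S).
Proof.
have [[[SL SLconv] _] [[SK SKconv] _]] := (L_form, K_form).
split=> [KL|[eta' [M [h [isoM [[Y Yconv alphaE] /(coeff_vec_row SLconv SKconv) kE]]]]]].
  have [eta' [M [isoM kE]]] := GKSL_eq_isometry SLconv SKconv L_form K_form L_minimal KL.
  have [Y Yconv _] := strong_sum_coeff SLconv (- adjoint M eta').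
  have [e e1] := GKSL_minimal_unit_vector L_minimal.
  pose D := alpha - beta - Y + (2^-1 * inner eta' eta') *: (1 : 'B(G)).
  have realE : (inner eta' eta')^* = inner eta' eta' by rewrite -inner_conj.
  have [h hD] : exists h : R, D = ('i%C * h%:C%C) *: (1 : 'B(G)).
    apply: (skew_derivation_scalar e1) => u v x y.
    have := (GKSL_rank1_eq SLconv SKconv L_form K_form).1 _ u v x y.
    rewrite (coeff_vec_gram isoM kE Yconv) KL => /(_ (fun _ _ => erefl)) gram.
    have DE w : D w = alpha w - beta w - Y w + (2^-1 * inner eta' eta') *: w by [].
    rewrite !DE !(innerDl, innerDr, innerNl, innerNr, innerZl, innerZr).
    rewrite rmorphM/= fmorphV/= rmorph_nat realE.
    move/eqP: gram; rewrite -subr_eq0 => /eqP gram; rewrite -[RHS]gram.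
    by field.
  exists eta', M, h; split=> //=; split; last first.
    exact: (coeff_vec_row SLconv SKconv eta' M).1.
  exists Y => //.
  by rewrite scalerBl -hD /D addrK -addrA subrK addrC subrK.
apply: (GKSL_eq_rank1 L_form K_form).
apply: (GKSL_rank1_eq SLconv SKconv L_form K_form).2 => u v x y.
rewrite (coeff_vec_gram isoM kE Yconv).
have realE : (inner eta' eta')^* = inner eta' eta' by rewrite -inner_conj.
have ci : ('i%C : R[i])^* = - 'i%C.
  by rewrite /Num.conj/=; apply/eqP; rewrite eq_complex/= oppr0 !eqxx.
have ch : (h%:C%C)^* = h%:C%C :> R[i].
  by rewrite /Num.conj/= oppr0.
have aE w : alpha w = beta w +
    ('i%C * h%:C%C - 2^-1 * inner eta' eta') *: w + Y w by rewrite alphaE.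
rewrite !aE !(innerDl, innerDr, innerZl, innerZr).
rewrite rmorphB !rmorphM/= fmorphV/= rmorph_nat realE ci ch.
by field.
Qed.
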